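(* Let $\eta, L\in\mathbb{C}$. If $$(e-1)\,|2L-1|+2|\eta|<\frac{e-1}{e^{2}},$$ then the normalized regular Coulomb wave function $z\mapsto g_{L,\eta}(z)$ is exponential starlike in the unit disk $\mathbb{D}=\{z\in\mathbb{C}:|z|<1\}$.
   Context: Regular Coulomb wave function. For $L,\eta\in\mathbb{C}$, the regular Coulomb wave function is $$F_{L,\eta}(z)=z^{L+1}e^{-iz}C_{L}(\eta)\,{}_{1}F_{1}\left(L+1-i\eta,2L+2;2iz\right)=C_{L}(\eta)\sum_{n\geq0}a_{L,n}z^{n+L+1},$$ where ${}_1F_1$ is the Kummer confluent hypergeometric function, $$C_{L}(\eta)=\frac{2^{L}e^{-\frac{\pi\eta}{2}}\left|\Gamma(L+1+i\eta)\right|}{\Gamma(2L+2)},$$ and $a_{L,0}=1$, $a_{L,1}=\frac{\eta}{L+1}$, $a_{L,n}=\frac{2\eta a_{L,n-1}-a_{L,n-2}}{n(n+2L+1)}$ for $n\geq 2$. Normalized form. $g_{L,\eta}(z)=C_{L}^{-1}(\eta)z^{-L}F_{L,\eta}(z)$, that is, $g_{L,\eta}(z)=\sum_{n\ge 0}a_{L,n}z^{n+1}=z e^{-iz}\,{}_1F_1(L+1-i\eta,2L+2;2iz)$. Function classes. $\mathcal{A}$ is the class of analytic functions $f$ on $\mathbb{D}$ with $f(0)=0$, $f'(0)=1$; $\mathcal{S}\subset\mathcal{A}$ is the subclass of univalent functions. For $f,g$ analytic in $\mathbb{D}$, $f\prec g$ ($f$ is subordinate to $g$) means that there is an analytic $w$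 on $\mathbb{D}$ with $w(0)=0$, $|w(z)|<1$ and $f(z)=g(w(z))$ for all $z\in\mathbb{D}$. A function $f$ is exponential starlike in $\mathbb{D}$ if it belongs to the class $\mathcal{S}_{e}^{\star}=\mathcal{S}^{\star}(e^{z})=\{f\in\mathcal{S}: zf'(z)/f(z)\prec e^{z}\}$ (equivalently, $|\log(zf'(z)/f(z))|<1$ in $\mathbb{D}$), where $zf'(z)/f(z)$ is understood to take the value $1$ at $z=0$. *)

(* Defs.v *)
From Stdlib Require Import Reals Factorial.
From Coquelicot Require Import Coquelicot.

Local Open Scope C_scope.

Definition Cexp (z : C) : C :=
  RtoC (exp (Re z)) * (cos (Im z), sin (Im z)).

(* A complex series converges iff its real and imaginary parts do; like
   [Series], this is the sum only when the series converges. *)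
Definition CSeries (u : nat -> C) : C :=
  (Series (fun n => Re (u n)), Series (fun n => Im (u n))).

(* Rising factorial a (a + 1) ... (a + n - 1). *)
Fixpoint Cpochhammer (a : C) (n : nat) : C :=
  match n with
  | O => 1
  | S m => Cpochhammer a m * (a + RtoC (INR m))
  end.

(* Kummer's 1F1(a, b; z), meaningful when b is not in {0, -1, -2, ...}. *)
Definition Kummer1F1 (a b z : C) : C :=
  CSeries (fun n =>
    Cpochhammer a n / Cpochhammer b n * (z ^ n / RtoC (INR (fact n)))).

(* The regular Coulomb wave function is
     F_{L,eta}(z) = z^(L+1) e^(-iz) C_L(eta) 1F1(L + 1 - i eta, 2L + 2; 2iz),
   and g_{L,eta}(z) = C_L(eta)^(-1) z^(-L) F_{L,eta}(z).  The constant C_L(eta)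
   and the multivalued power z^L cancel, which leaves an entire function. *)
Definition Coulomb_g (L eta z : C) : C :=
  z * Cexp (- (Ci * z)) *
  Kummer1F1 (L + 1 - Ci * eta) (2 * L + 2) (2 * Ci * z).

Definition in_disk (z : C) : Prop := (Cmod z < 1)%R.

(* Functions on the unit disk are total functions C -> C of which only the
   values on the disk matter.  Analytic = complex differentiable at each point
   of the (open) disk. *)
Definition analytic_disk (f : C -> C) : Prop :=
  forall z : C, in_disk z ->
    ex_derive (K := C_AbsRing) (V := C_NormedModule) f z.

Definition class_A (f : C -> C) : Prop :=
  analytic_disk f /\ f 0 = 0 /\ C_derive f 0 = 1.

Definition univalent_disk (f : C -> C) : Prop :=
  forall x y : C, in_disk x -> in_disk y -> f x = f y -> x = y.

Definition class_S (f : C -> C) : Prop :=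
  class_A f /\ univalent_disk f.

Definition subordinate (f g : C -> C) : Prop :=
  analytic_disk f /\ analytic_disk g /\
  exists w : C -> C,
    analytic_disk w /\ w 0 = 0 /\
    forall z : C, in_disk z -> (Cmod (w z) < 1)%R /\ f z = g (w z).

(* z f'(z) / f(z), with its limit value 1 at the zero z = 0 of f in A. *)
Definition starlike_quotient (f : C -> C) (z : C) : C :=
  if Ceq_dec z 0 then 1 else z * C_derive f z / f z.

Definition class_S_star (phi f : C -> C) : Prop :=
  class_S f /\ subordinate (starlike_quotient f) phi.

Definition exponential_starlike (f : C -> C) : Prop := class_S_star Cexp f.

(* Main.v *)
Require Import Defs.
From Stdlib Require Import Reals Lra Lia Psatz Factorial.
From Coquelicot Require Import Coquelicot.

(** Write [g z = z * h z] with [h z] the sum of [a_n z^n] and [a_0 = 1]. The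
    assumption keeps [L] near 1/2 and [eta] near 0, where the recurrence

      [n (n + 2L + 1) a_n = 2 eta a_(n-1) - a_(n-2)]

    makes the coefficients so small that the sum [S] of [(2n + 1) |a_n|] over
    [n >= 1] is less than 1 ([majorant_sum]). Everything follows from [S < 1]
    ([exponential_starlike_of_coef]):

    - [|g x - g y - (x - y)| <= S |x - y|], so [g] is univalent;
    - [z g' / g = g' / h], and [|g' - h|] is at most the sum [A] of [n |a_n|]
      while [|h|] is at least [1 - B], [B] being the sum of [|a_n|]; since
      [2 A + B = S < 1], the quotient stays in the disk of centre 1 and
      radius 1/2;
    - on that disk the principal logarithm is analytic with modulus less
      than 1 ([Cmod_Clog], [Cderiv_Clog]), and it provides the function
      required by the subordination to [e^z].

    The rest links the closed form [z e^(-iz) 1F1(a, b; 2iz)] to the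
    recurrence: the exponential is identified with its power series
    ([Cexp_CPSeries]), the product with a Cauchy product ([CPSeries_mult]), and
    the convolution of the two coefficient sequences is shown to satisfy the
    recurrence ([coulomb_coef_rec]). Complex differentiation of power series
    rests on quadratic remainder estimates ([Cderiv_quadratic],
    [Cpow_taylor1]). *)

Local Open Scope R_scope.

(** * Moduli of complex numbers *)

Lemma Ceq_Re_Im (z w : C) : Re z = Re w -> Im z = Im w -> z = w.
Proof. destruct z, w; simpl; congruence. Qed.

Lemma Re_le_Cmod (z : C) : Rabs (Re z) <= Cmod z.
Proof. eapply Rle_trans; [apply Rmax_l | apply Rmax_Cmod]. Qed.

Lemma Im_le_Cmod (z : C) : Rabs (Im z) <= Cmod z.
Proof.
destruct z as [x y]; unfold Cmod; simpl Im; simpl fst; simpl snd.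
apply Rsqr_incr_0_var; [| apply sqrt_pos].
rewrite Rsqr_sqrt by nra. rewrite <- Rsqr_abs. unfold Rsqr; nra.
Qed.

Lemma Cmod_le_Re_Im (z : C) : Cmod z <= Rabs (Re z) + Rabs (Im z).
Proof.
destruct z as [x y]; unfold Cmod; simpl Re; simpl Im; simpl fst; simpl snd.
apply Rsqr_incr_0_var.
- rewrite Rsqr_sqrt by nra.
  rewrite <- (pow2_abs x), <- (pow2_abs y).
  generalize (Rabs_pos x) (Rabs_pos y). unfold Rsqr; nra.
- generalize (Rabs_pos x) (Rabs_pos y); lra.
Qed.

Lemma Cmod_sqr (z : C) : Cmod z ^ 2 = Re z ^ 2 + Im z ^ 2.
Proof. unfold Cmod; rewrite pow2_sqrt; [reflexivity | nra]. Qed.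

Lemma Cmod_Ci : Cmod Ci = 1.
Proof. unfold Cmod, Ci; simpl. replace (0 * (0 * 1) + 1 * (1 * 1)) with 1 by ring. apply sqrt_1. Qed.

(** * Complex derivatives *)

Notation Cderiv f z d :=
  (is_derive (K := C_AbsRing) (V := C_NormedModule) f z d).

Lemma Cderiv_eps (f : C -> C) (z d : C) :
  Cderiv f z d <->
  forall eps : posreal, exists delta : posreal, forall y : C,
    Cmod (y - z)%C < delta ->
    Cmod (f y - f z - (y - z) * d)%C <= eps * Cmod (y - z)%C.
Proof.
split.
- intros [_ H] eps.
  destruct (H z (fun P HP => HP) eps) as [delta Hd].
  exists delta; intros y Hy. exact (Hd y Hy).
- intros H; split; [apply is_linear_scal_l |].
  intros x Hx eps.
  apply (is_filter_lim_locally_unique (V := AbsRing_NormedModule C_AbsRing)) in Hx; subst x.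
  destruct (H eps) as [delta Hd].
  exists delta; intros y Hy. exact (Hd y Hy).
Qed.

(** Over [C] the product uniform structure and the one of the modulus are
    different terms; going through [eps] and [delta] makes the product rule,
    stated for the second, available for the first. *)
Lemma Cderiv_ring (f : C -> C) (z d : C) :
  Cderiv f z d <->
  is_derive (K := C_AbsRing) (V := AbsRing_NormedModule C_AbsRing) f z d.
Proof.
rewrite Cderiv_eps; split.
- intros H; split; [apply is_linear_scal_l |].
  intros x Hx eps.
  apply (is_filter_lim_locally_unique (V := AbsRing_NormedModule C_AbsRing)) in Hx; subst x.
  destruct (H eps) as [delta Hd].
  exists delta; intros y Hy. exact (Hd y Hy).
- intros [_ H] eps.
  destruct (H z (fun P HP => HP) eps) as [delta Hd].
  exists delta; intros y Hy. exact (Hd y Hy).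
Qed.

Lemma Cderiv_ext_disk (f g : C -> C) (z d : C) :
  (forall y, in_disk y -> f y = g y) -> in_disk z -> Cderiv g z d -> Cderiv f z d.
Proof.
intros Hfg Hz Hg; apply Cderiv_eps; intros eps.
destruct (proj1 (Cderiv_eps g z d) Hg eps) as [delta Hd].
assert (Hp : 0 < Rmin delta (1 - Cmod z)).
{ apply Rmin_pos; [apply cond_pos | unfold in_disk in Hz; lra]. }
exists (mkposreal _ Hp); simpl; intros y Hy.
assert (H1 : Cmod (y - z)%C < delta) by (eapply Rlt_le_trans; [exact Hy | apply Rmin_l]).
assert (H2 : Cmod (y - z)%C < 1 - Cmod z) by (eapply Rlt_le_trans; [exact Hy | apply Rmin_r]).
rewrite !Hfg; [now apply Hd | exact Hz |].
unfold in_disk. replace y with ((y - z) + z)%C by ring.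
eapply Rle_lt_trans; [apply Cmod_triangle | lra].
Qed.

(** All derivatives computed from scratch below (reciprocal, exponential,
    power series) come from an explicit quadratic bound on the Taylor
    remainder. *)
Lemma Cderiv_quadratic (f : C -> C) (z d : C) (r M : R) :
  0 < r ->
  (forall y : C, Cmod (y - z)%C < r ->
     Cmod (f y - f z - (y - z) * d)%C <= M * Cmod (y - z)%C ^ 2) ->
  Cderiv f z d.
Proof.
intros Hr H; apply Cderiv_eps; intros [eps Heps]; simpl.
set (N := Rmax M 1).
assert (HN : 0 < N) by (unfold N; generalize (Rmax_r M 1); lra).
assert (Hd : 0 < Rmin r (eps / N)).
{ apply Rmin_pos; [exact Hr | apply Rdiv_lt_0_compat; assumption]. }
exists (mkposreal _ Hd); simpl; intros y Hy.
assert (H1 : Cmod (y - z)%C < r) by (eapply Rlt_le_trans; [exact Hy | apply Rmin_l]).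
assert (H2 : Cmod (y - z)%C < eps / N) by (eapply Rlt_le_trans; [exact Hy | apply Rmin_r]).
eapply Rle_trans; [exact (H y H1) |].
generalize (Cmod_ge_0 (y - z)%C); intros H0.
set (m := Cmod (y - z)%C) in *.
apply Rle_trans with (N * m ^ 2).
- apply Rmult_le_compat_r; [apply pow2_ge_0 | apply Rmax_l].
- replace (N * m ^ 2) with ((N * m) * m) by ring.
  apply Rmult_le_compat_r; [exact H0 |].
  apply Rmult_lt_compat_l with (r := N) in H2; [| exact HN].
  replace (N * (eps / N)) with eps in H2 by (field; lra). lra.
Qed.

Lemma Cderiv_mult (f g : C -> C) (z df dg : C) :
  Cderiv f z df -> Cderiv g z dg ->
  Cderiv (fun x => f x * g x)%C z (df * g z + f z * dg)%C.
Proof.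
intros Hf Hg; apply Cderiv_ring.
apply (is_derive_mult (K := C_AbsRing) f g z df dg);
  [now apply Cderiv_ring | now apply Cderiv_ring | exact Cmult_comm].
Qed.

Lemma Cderiv_comp (f g : C -> C) (z df dg : C) :
  Cderiv f (g z) df -> Cderiv g z dg -> Cderiv (fun x => f (g x)) z (dg * df)%C.
Proof.
intros Hf Hg.
apply (is_derive_comp (K := C_AbsRing) (V := C_NormedModule) f g z df dg);
  [exact Hf | now apply Cderiv_ring].
Qed.

Lemma Cderiv_Cinv (z : C) : z <> 0%C -> Cderiv Cinv z (- / (z * z))%C.
Proof.
intros Hz.
assert (Hm : 0 < Cmod z) by now apply Cmod_gt_0.
apply Cderiv_quadratic with (r := Cmod z / 2) (M := 2 / Cmod z ^ 3); [lra |].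
intros y Hy.
assert (H1 : Cmod z / 2 <= Cmod y).
{ assert (H := Cmod_triangle y (- (y - z))%C).
  replace (y + - (y - z))%C with z in H by ring.
  rewrite Cmod_opp in H. lra. }
assert (Hy0 : y <> 0%C) by (apply Cmod_gt_0; lra).
replace (/ y - / z - (y - z) * - / (z * z))%C
  with ((y - z) * (y - z) / (z * z * y))%C by (field; auto).
rewrite Cmod_div by (repeat apply Cmult_neq_0; assumption).
rewrite !Cmod_mult.
apply (Rmult_le_reg_r (Cmod z * Cmod z * Cmod y)).
{ repeat apply Rmult_lt_0_compat; lra. }
set (m := Cmod (y - z)%C). set (a := Cmod z) in *. set (b := Cmod y) in *.
replace (m * m / (a * a * b) * (a * a * b)) with (m ^ 2) by (field; lra).
replace (2 / a ^ 3 * m ^ 2 * (a * a * b)) with (m ^ 2 * (2 * b / a)) by (field; lra).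
rewrite <- (Rmult_1_r (m ^ 2)) at 1.
apply Rmult_le_compat_l; [apply pow2_ge_0 |].
apply Rle_div_r; lra.
Qed.

Lemma Rderiv_eps (f : R -> R) (t d : R) :
  (forall eps : posreal, exists delta : posreal, forall y,
     Rabs (y - t) < delta -> Rabs (f y - f t - (y - t) * d) <= eps * Rabs (y - t)) ->
  is_derive f t d.
Proof.
intros H; split; [apply (is_linear_scal_l d) |].
intros x Hx eps.
apply (is_filter_lim_locally_unique (V := AbsRing_NormedModule R_AbsRing)) in Hx; subst x.
destruct (H eps) as [delta Hd].
exists delta; intros y Hy. exact (Hd y Hy).
Qed.

(** The disk is star-shaped at 0, so the real mean value theorem applied to
    the real and imaginary parts of [t |-> f (t z)] suffices. *)
Lemma Cderiv_zero_const (f : C -> C) (z : C) :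
  (forall y, in_disk y -> Cderiv f y (RtoC 0)) -> in_disk z -> f z = f 0%C.
Proof.
intros Hf Hz; unfold in_disk in Hz.
assert (Hp : forall p : C -> R,
  (forall u v, p (u - v)%C = p u - p v) -> (forall u, Rabs (p u) <= Cmod u) ->
  p (f z) = p (f 0%C)).
{ intros p Hlin Hle.
  set (h := fun t : R => p (f (RtoC t * z)%C)).
  assert (H : Rabs (h 1 - h 0) <= 0 * Rabs (1 - 0)).
  { apply bounded_variation with (dh := fun _ => 0).
    intros t Ht; split; [| rewrite Rabs_R0; lra].
    rewrite !Rminus_0_r, Rabs_R1 in Ht.
    assert (Htz : in_disk (RtoC t * z)%C).
    { unfold in_disk; rewrite Cmod_mult, Cmod_R.
      generalize (Rabs_pos t) (Cmod_ge_0 z); nra. }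
    apply Rderiv_eps; intros eps.
    destruct (proj1 (Cderiv_eps _ _ _) (Hf _ Htz) eps) as [delta Hd].
    exists delta; intros y Hy.
    assert (E : (RtoC y * z - RtoC t * z)%C = (RtoC (y - t) * z)%C)
      by (rewrite RtoC_minus; ring).
    assert (Hm : Cmod (RtoC y * z - RtoC t * z)%C <= Rabs (y - t)).
    { rewrite E, Cmod_mult, Cmod_R. generalize (Rabs_pos (y - t)) (Cmod_ge_0 z); nra. }
    unfold h; rewrite Rmult_0_r, Rminus_0_r, <- Hlin.
    eapply Rle_trans; [apply Hle |].
    assert (K := Hd (RtoC y * z)%C ltac:(lra)).
    rewrite Cmult_0_r in K. unfold Cminus at 1 in K.
    rewrite Copp_0, Cplus_0_r in K.
    eapply Rle_trans; [exact K |].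
    apply Rmult_le_compat_l; [left; apply cond_pos | exact Hm]. }
  unfold h in H; rewrite Cmult_1_l, Cmult_0_l, Rmult_0_l in H.
  assert (H' := Rabs_pos (p (f z) - p (f 0%C))).
  assert (H0 : Rabs (p (f z) - p (f 0%C)) = 0) by lra.
  destruct (Req_dec (p (f z) - p (f 0%C)) 0) as [E | E]; [lra |].
  apply Rabs_no_R0 in E; contradiction. }
apply Ceq_Re_Im; apply Hp; auto using Re_le_Cmod, Im_le_Cmod;
  intros [a b] [c d]; reflexivity.
Qed.

(** With [u = g z - g z0], differentiability of [f] reads
    [z - z0 = u d + o(u)]; solving for [u] first shows that [u] is [O(z - z0)],
    and then that the error is [o(z - z0)]. *)
Lemma Cderiv_inverse (f g : C -> C) (z0 d : C) :
  d <> 0%C -> Cderiv f (g z0) d ->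
  (exists r, 0 < r /\ forall z, Cmod (z - z0)%C < r -> f (g z) = z) ->
  (forall eps : posreal, exists delta : posreal, forall z,
     Cmod (z - z0)%C < delta -> Cmod (g z - g z0)%C < eps) ->
  Cderiv g z0 (/ d)%C.
Proof.
intros Hd Hf [r [Hr Hfg]] Hg.
assert (HD : 0 < Cmod d) by now apply Cmod_gt_0.
set (D := Cmod d) in *.
apply Cderiv_eps; intros eps.
assert (He : 0 < Rmin (D / 2) (eps * D ^ 2 / 2)).
{ apply Rmin_pos; [lra |]. generalize (cond_pos eps); intros.
  assert (0 < D ^ 2) by nra. nra. }
set (e1 := mkposreal _ He).
destruct (proj1 (Cderiv_eps f (g z0) d) Hf e1) as [d1 Hd1].
destruct (Hg d1) as [d2 Hd2].
assert (Hd3 : 0 < Rmin d2 r) by (apply Rmin_pos; [apply cond_pos | exact Hr]).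
exists (mkposreal _ Hd3); simpl; intros z Hz.
assert (Hz1 : Cmod (z - z0)%C < d2) by (eapply Rlt_le_trans; [exact Hz | apply Rmin_l]).
assert (Hz2 : Cmod (z - z0)%C < r) by (eapply Rlt_le_trans; [exact Hz | apply Rmin_r]).
assert (K := Hd1 (g z) (Hd2 z Hz1)).
rewrite (Hfg z Hz2) in K. rewrite (Hfg z0) in K
  by (replace (z0 - z0)%C with (RtoC 0) by ring; rewrite Cmod_0; exact Hr).
assert (L1 : e1 <= D / 2) by apply Rmin_l.
assert (L2 : e1 <= eps * D ^ 2 / 2) by apply Rmin_r.
set (u := (g z - g z0)%C) in *. set (v := (z - z0)%C) in *.
assert (Hu : D * Cmod u <= 2 * Cmod v).
{ assert (T := Cmod_triangle v (- (v - u * d))%C).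
  replace (v + - (v - u * d))%C with (u * d)%C in T by ring.
  rewrite Cmod_opp, Cmod_mult in T. fold D in T.
  assert (e1 * Cmod u <= D / 2 * Cmod u)
    by (apply Rmult_le_compat_r; [apply Cmod_ge_0 | exact L1]).
  lra. }
replace (u - v * / d)%C with (- (v - u * d) * / d)%C by (field; exact Hd).
rewrite Cmod_mult, Cmod_opp, Cmod_inv by exact Hd. fold D.
apply Rmult_le_reg_r with (D * D); [nra |].
replace (Cmod (v - u * d)%C * / D * (D * D)) with (D * Cmod (v - u * d)%C) by (field; lra).
apply Rle_trans with (D * (e1 * Cmod u)); [apply Rmult_le_compat_l; lra |].
replace (D * (e1 * Cmod u)) with (e1 * (D * Cmod u)) by ring.
apply Rle_trans with (e1 * (2 * Cmod v)).
{ apply Rmult_le_compat_l; [left; apply cond_pos | exact Hu]. }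
replace (eps * Cmod v * (D * D)) with (eps * D ^ 2 / 2 * (2 * Cmod v)) by field.
apply Rmult_le_compat_r; [generalize (Cmod_ge_0 v); lra | exact L2].
Qed.

(** * The complex exponential *)

(** The upper bound comes from [exp (- x) >= 1 - x], which gives
    [exp x <= 1 / (1 - x)]. *)
Lemma exp_taylor1 (x : R) : Rabs x <= 1 / 2 -> Rabs (exp x - 1 - x) <= 2 * x ^ 2.
Proof.
intros Hx. apply Rabs_le_between in Hx.
assert (H1 : 1 + x <= exp x).
{ destruct (Req_dec x 0) as [-> | Hn]; [rewrite exp_0; lra | left; now apply exp_ineq1]. }
assert (H2 : 1 - x <= exp (- x)).
{ destruct (Req_dec x 0) as [-> | Hn]; [rewrite Ropp_0, exp_0; lra | left; apply exp_ineq1; lra]. }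
assert (H3 : exp x * exp (- x) = 1) by (rewrite <- exp_plus, Rplus_opp_r; apply exp_0).
assert (H4 := exp_pos x).
assert (H5 : exp x * (1 - x) <= 1) by (rewrite <- H3; apply Rmult_le_compat_l; lra).
rewrite Rabs_pos_eq by lra. nra.
Qed.

Lemma sin_le_id (y : R) : Rabs (sin y) <= Rabs y.
Proof.
replace (sin y) with (sin y - sin 0) by (rewrite sin_0; ring).
replace (Rabs y) with (1 * Rabs (y - 0)) by (rewrite Rminus_0_r; ring).
apply bounded_variation with (dh := cos); intros t _; split.
- apply is_derive_sin.
- apply Rabs_le, COS_bound.
Qed.

Lemma cos_taylor1 (y : R) : Rabs (cos y - 1) <= y ^ 2 / 2.
Proof.
replace y with (2 * (y / 2)) at 1 by field. rewrite cos_2a_sin.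
replace (1 - 2 * sin (y / 2) * sin (y / 2) - 1) with (- (2 * sin (y / 2) ^ 2)) by ring.
rewrite Rabs_Ropp, Rabs_pos_eq by nra.
assert (H : sin (y / 2) ^ 2 <= (y / 2) ^ 2).
{ rewrite <- !Rsqr_pow2. apply Rsqr_le_abs_1, sin_le_id. }
nra.
Qed.

Lemma sin_taylor1 (y : R) : Rabs y <= 1 -> Rabs (sin y - y) <= y ^ 2.
Proof.
intros Hy.
replace (sin y - y) with ((sin y - y) - (sin 0 - 0)) by (rewrite sin_0; ring).
replace (y ^ 2) with (Rabs y * Rabs (y - 0))
  by (rewrite Rminus_0_r, <- Rabs_mult, Rabs_pos_eq; nra).
apply bounded_variation with (h := fun t => sin t - t) (dh := fun t => cos t - 1).
intros t Ht; rewrite !Rminus_0_r in Ht; split; [auto_derive; trivial; ring |].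
eapply Rle_trans; [apply cos_taylor1 |].
rewrite <- (pow2_abs t). generalize (Rabs_pos t); nra.
Qed.

Lemma Cexp_plus (z w : C) : Cexp (z + w)%C = (Cexp z * Cexp w)%C.
Proof.
destruct z as [x y], w as [u v]; unfold Cexp; simpl Re; simpl Im.
rewrite exp_plus, cos_plus, sin_plus.
apply Ceq_Re_Im; simpl; ring.
Qed.

Lemma Cexp_0 : Cexp 0%C = 1%C.
Proof.
unfold Cexp; simpl Re; simpl Im; rewrite exp_0, cos_0, sin_0.
apply Ceq_Re_Im; simpl; ring.
Qed.

Lemma Cexp_taylor1 (h : C) :
  Cmod h <= 1 / 2 -> Cmod (Cexp h - 1 - h)%C <= 7 * Cmod h ^ 2.
Proof.
intros Hh.
assert (Hx : Rabs (Re h) <= Cmod h) by apply Re_le_Cmod.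
assert (Hy := Im_le_Cmod h).
destruct h as [x y]; simpl in Hx, Hy; set (m := Cmod (x, y)) in *.
assert (E := exp_taylor1 x ltac:(lra)).
assert (Co := cos_taylor1 y).
assert (S := sin_taylor1 y ltac:(lra)).
assert (Hx2 : x ^ 2 <= m ^ 2) by (rewrite <- (pow2_abs x); generalize (Rabs_pos x); nra).
assert (Hy2 : y ^ 2 <= m ^ 2) by (rewrite <- (pow2_abs y); generalize (Rabs_pos y); nra).
assert (Hxm : - m <= x <= m) by now apply Rabs_le_between.
assert (Hym : - m <= y <= m) by now apply Rabs_le_between.
eapply Rle_trans; [apply Cmod_le_Re_Im |].
unfold Cexp; simpl.
(* Split e^x cos y - 1 - x and e^x sin y - y into one-variable remainders. *)
match goal with |- Rabs ?a + Rabs ?b <= _ =>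
  replace a with ((exp x - 1 - x) + exp x * (cos y - 1)) by ring;
  replace b with (exp x * (sin y - y) + y * (exp x - 1 - x) + x * y) by ring
end.
assert (Ex : 0 < exp x <= 2).
{ split; [apply exp_pos |]. apply Rabs_le_between in E. nra. }
assert (T1 : Rabs (exp x * (cos y - 1)) <= 2 * (y ^ 2 / 2)).
{ rewrite Rabs_mult, (Rabs_pos_eq (exp x)) by lra.
  apply Rmult_le_compat; try lra; apply Rabs_pos. }
assert (T2 : Rabs (exp x * (sin y - y)) <= 2 * y ^ 2).
{ rewrite Rabs_mult, (Rabs_pos_eq (exp x)) by lra.
  apply Rmult_le_compat; try lra; apply Rabs_pos. }
assert (T3 : Rabs (y * (exp x - 1 - x)) <= (1 / 2) * (2 * x ^ 2)).
{ rewrite Rabs_mult. apply Rmult_le_compat; try lra; apply Rabs_pos. }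
assert (T4 : Rabs (x * y) <= m * m).
{ rewrite Rabs_mult. apply Rmult_le_compat; try lra; apply Rabs_pos. }
assert (U1 := Rabs_triang (exp x - 1 - x) (exp x * (cos y - 1))).
assert (U2 := Rabs_triang (exp x * (sin y - y) + y * (exp x - 1 - x)) (x * y)).
assert (U3 := Rabs_triang (exp x * (sin y - y)) (y * (exp x - 1 - x))).
lra.
Qed.

Lemma Cderiv_Cexp (z : C) : Cderiv Cexp z (Cexp z).
Proof.
apply Cderiv_quadratic with (r := 1 / 2) (M := 7 * Cmod (Cexp z)); [lra |].
intros y Hy.
replace (Cexp y) with (Cexp z * Cexp (y - z))%C
  by (rewrite <- Cexp_plus; f_equal; ring).
replace (Cexp z * Cexp (y - z) - Cexp z - (y - z) * Cexp z)%C
  with (Cexp z * (Cexp (y - z) - 1 - (y - z)))%C by ring.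
rewrite Cmod_mult.
replace (7 * Cmod (Cexp z) * Cmod (y - z)%C ^ 2)
  with (Cmod (Cexp z) * (7 * Cmod (y - z)%C ^ 2)) by ring.
apply Rmult_le_compat_l; [apply Cmod_ge_0 | apply Cexp_taylor1; lra].
Qed.

(** * Absolutely convergent complex series *)

Lemma ex_series_Rscal (c : R) (u : nat -> R) :
  ex_series u -> ex_series (fun n => c * u n).
Proof. exact (ex_series_scal_l (K := R_AbsRing) (V := R_NormedModule) c u). Qed.

Definition Csummable (u : nat -> C) : Prop := ex_series (fun n => Cmod (u n)).

Lemma Csummable_le (u : nat -> C) (v : nat -> R) :
  (forall n, Cmod (u n) <= v n) -> ex_series v -> Csummable u.
Proof.
intros H Hv. apply (ex_series_le (V := R_CompleteNormedModule)) with v; [| exact Hv].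
intros n. change (Rabs (Cmod (u n)) <= v n).
rewrite Rabs_pos_eq by apply Cmod_ge_0. apply H.
Qed.

Lemma Csummable_Re_Im (u : nat -> C) :
  Csummable u ->
  ex_series (fun n => Rabs (Re (u n))) /\ ex_series (fun n => Rabs (Im (u n))).
Proof.
intros H; split;
  apply (ex_series_le (V := R_CompleteNormedModule)) with (2 := H); intros n;
  [change (Rabs (Rabs (Re (u n))) <= Cmod (u n)) | change (Rabs (Rabs (Im (u n))) <= Cmod (u n))];
  rewrite Rabs_Rabsolu; [apply Re_le_Cmod | apply Im_le_Cmod].
Qed.

Lemma Csummable_parts (u : nat -> C) :
  Csummable u ->
  ex_series (fun n => Re (u n)) /\ ex_series (fun n => Im (u n)).
Proof.
intros H; apply Csummable_Re_Im in H; destruct H; split; now apply ex_series_Rabs.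
Qed.

Lemma CSeries_ext (u v : nat -> C) : (forall n, u n = v n) -> CSeries u = CSeries v.
Proof. intros H; unfold CSeries; f_equal; apply Series_ext; intros n; now rewrite H. Qed.

Lemma CSeries_plus (u v : nat -> C) :
  Csummable u -> Csummable v ->
  CSeries (fun n => u n + v n)%C = (CSeries u + CSeries v)%C.
Proof.
intros Hu Hv; apply Csummable_parts in Hu, Hv; destruct Hu, Hv.
unfold CSeries; apply Ceq_Re_Im; simpl; rewrite <- Series_plus by assumption;
  apply Series_ext; intros n; reflexivity.
Qed.

Lemma CSeries_scal (c : C) (u : nat -> C) :
  Csummable u -> CSeries (fun n => c * u n)%C = (c * CSeries u)%C.
Proof.
intros Hu; apply Csummable_parts in Hu; destruct Hu as [H1 H2].
unfold CSeries; apply Ceq_Re_Im; simpl.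
- rewrite <- !Series_scal_l, <- Series_minus;
    [apply Series_ext; intros n; reflexivity | |];
    now apply ex_series_Rscal.
- rewrite <- !Series_scal_l, <- Series_plus;
    [apply Series_ext; intros n; reflexivity | |];
    now apply ex_series_Rscal.
Qed.

Lemma Csummable_scal (c : C) (u : nat -> C) :
  Csummable u -> Csummable (fun n => c * u n)%C.
Proof.
intros Hu; eapply Csummable_le; [intros n; right; apply Cmod_mult |].
now apply ex_series_Rscal.
Qed.

Lemma CSeries_minus (u v : nat -> C) :
  Csummable u -> Csummable v ->
  CSeries (fun n => u n - v n)%C = (CSeries u - CSeries v)%C.
Proof.
intros Hu Hv.
rewrite (CSeries_ext _ (fun n => u n + (- (1)) * v n)%C) by (intros n; ring).
rewrite CSeries_plus, CSeries_scal; auto using Csummable_scal. ring.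
Qed.

(** If [l] is the sum, then [|l|^2 = Re (conj l * l)] is the sum of the real
    numbers [Re (conj l * u n)], each at most [|l| |u n|]; dividing by [|l|]
    reduces the triangle inequality for complex series to the real one. *)
Lemma Cmod_CSeries_le (u : nat -> C) (v : nat -> R) :
  (forall n, Cmod (u n) <= v n) -> ex_series v -> Cmod (CSeries u) <= Series v.
Proof.
intros H Hv.
assert (Hu := Csummable_le u v H Hv).
assert (Hp := Csummable_parts u Hu); destruct Hp as [H1 H2].
set (l := CSeries u).
assert (Hl : Cmod l ^ 2 = Series (fun n => Re l * Re (u n) + Im l * Im (u n))).
{ rewrite Series_plus by now apply ex_series_Rscal.
  rewrite !Series_scal_l.
  change (Series (fun n => Re (u n))) with (Re l).
  change (Series (fun n => Im (u n))) with (Im l).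
  unfold Cmod; rewrite pow2_sqrt by nra. simpl; unfold Re, Im; ring. }
assert (Hle : Cmod l ^ 2 <= Cmod l * Series v).
{ rewrite Hl, <- Series_scal_l. 
  assert (Hb : forall n, Rabs (Re l * Re (u n) + Im l * Im (u n)) <= Cmod l * v n).
  { intros n. apply Rle_trans with (Cmod l * Cmod (u n)).
    - replace (Re l * Re (u n) + Im l * Im (u n)) with (Re (Cconj l * u n)%C)
        by (unfold Re, Im; simpl; ring).
      eapply Rle_trans; [apply Re_le_Cmod |].
      rewrite Cmod_mult, Cmod_conj. lra.
    - apply Rmult_le_compat_l; [apply Cmod_ge_0 | apply H]. }
  assert (Hs : ex_series (fun n => Cmod l * v n))
    by now apply ex_series_Rscal.
  eapply Rle_trans; [apply Rle_abs |].
  eapply Rle_trans; [apply Series_Rabs |].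
  - apply (ex_series_le (V := R_CompleteNormedModule)) with (2 := Hs).
    intros n; change (Rabs (Rabs (Re l * Re (u n) + Im l * Im (u n))) <= Cmod l * v n).
    rewrite Rabs_Rabsolu; apply Hb.
  - apply Series_le; [| exact Hs]. intros n; split; [apply Rabs_pos | apply Hb]. }
destruct (Cmod_ge_0 l) as [Hpos | Hz].
- apply Rmult_le_reg_l with (Cmod l); [exact Hpos |]. lra.
- rewrite <- Hz.
  rewrite <- (Rmult_0_l (Series v)), <- Series_scal_l.
  apply Series_le; [| exact Hv].
  intros n; rewrite Rmult_0_l; split; [lra |].
  eapply Rle_trans; [apply Cmod_ge_0 | apply H].
Qed.

Lemma CSeries_incr_1 (u : nat -> C) :
  Csummable u -> CSeries u = (u O + CSeries (fun n => u (S n)))%C.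
Proof.
intros Hu; apply Csummable_parts in Hu; destruct Hu as [H1 H2].
unfold CSeries; apply Ceq_Re_Im; simpl; rewrite Series_incr_1 by assumption; reflexivity.
Qed.

Definition Cconv (u v : nat -> C) (n : nat) : C :=
  sum_n (fun k => u k * v (n - k)%nat)%C n.

Lemma Re_Im_sum_n (f : nat -> C) (n : nat) :
  sum_n f n = (sum_f_R0 (fun k => Re (f k)) n, sum_f_R0 (fun k => Im (f k)) n).
Proof.
induction n as [| n IH].
- rewrite sum_O; apply Ceq_Re_Im; reflexivity.
- rewrite sum_Sn, IH. reflexivity.
Qed.

(** The real and imaginary parts of the convolution are
    combinations of the four real Cauchy products. *)
Lemma CSeries_conv (u v : nat -> C) :
  Csummable u -> Csummable v ->
  CSeries (Cconv u v) = (CSeries u * CSeries v)%C.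
Proof.
intros Hu Hv.
destruct (Csummable_parts u Hu) as [u1 u2]; destruct (Csummable_parts v Hv) as [v1 v2].
destruct (Csummable_Re_Im u Hu) as [u3 u4]; destruct (Csummable_Re_Im v Hv) as [v3 v4].
assert (R11 := is_series_mult _ _ _ _ (Series_correct _ u1) (Series_correct _ v1) u3 v3).
assert (R12 := is_series_mult _ _ _ _ (Series_correct _ u1) (Series_correct _ v2) u3 v4).
assert (R21 := is_series_mult _ _ _ _ (Series_correct _ u2) (Series_correct _ v1) u4 v3).
assert (R22 := is_series_mult _ _ _ _ (Series_correct _ u2) (Series_correct _ v2) u4 v4).
unfold CSeries; apply Ceq_Re_Im; cbn [Re Im fst snd Cmult]; apply is_series_unique.
- eapply is_series_ext; [| exact (is_series_minus _ _ _ _ R11 R22)].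
  intros n; unfold Cconv; rewrite Re_Im_sum_n.
  change (sum_f_R0 (fun k => Re (u k) * Re (v (n - k)%nat)) n
    - sum_f_R0 (fun k => Im (u k) * Im (v (n - k)%nat)) n
    = sum_f_R0 (fun k => Re (u k) * Re (v (n - k)%nat) - Im (u k) * Im (v (n - k)%nat)) n).
  now rewrite <- minus_sum.
- eapply is_series_ext; [| exact (is_series_plus _ _ _ _ R12 R21)].
  intros n; unfold Cconv; rewrite Re_Im_sum_n.
  change (sum_f_R0 (fun k => Re (u k) * Im (v (n - k)%nat)) n
    + sum_f_R0 (fun k => Im (u k) * Re (v (n - k)%nat)) n
    = sum_f_R0 (fun k => Re (u k) * Im (v (n - k)%nat) + Im (u k) * Re (v (n - k)%nat)) n).
  now rewrite <- sum_plus.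
Qed.

(** * Convolution of coefficient sequences *)

Local Open Scope C_scope.

(** Finite sums leave equations typed in an algebraic structure carried by
    [C], which [ring] does not recognize. *)
Ltac Cring := match goal with |- @eq _ ?x ?y => change (@eq C x y) end; ring.

(** The operator [z d/dz] on coefficient sequences; multiplication by [z] is
    [shift]. With these two, differential equations for power series become
    identities between sequences. *)
Definition euler (u : nat -> C) (n : nat) : C := INR n * u n.

Definition shift (u : nat -> C) (n : nat) : C :=
  match n with O => 0 | S m => u m end.

Lemma Csum_Sn (f : nat -> C) (n : nat) : sum_n f (S n) = sum_n f n + f (S n).
Proof. exact (sum_Sn f n). Qed.

Lemma Csum_first (f : nat -> C) (n : nat) :
  sum_n f (S n) = f O + sum_n (fun k => f (S k)) n.
Proof.
induction n as [| n IH].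
- now rewrite Csum_Sn, !sum_O.
- rewrite Csum_Sn, IH, (Csum_Sn (fun k => f (S k))). Cring.
Qed.

Lemma Csum_plus (f g : nat -> C) (n : nat) :
  sum_n (fun k => f k + g k) n = sum_n f n + sum_n g n.
Proof. exact (sum_n_plus f g n). Qed.

Lemma Csum_scal (c : C) (f : nat -> C) (n : nat) :
  sum_n (fun k => c * f k) n = c * sum_n f n.
Proof. exact (sum_n_mult_l (K := C_Ring) c f n). Qed.

Lemma Cconv_ext_l (u u' v : nat -> C) (n : nat) :
  (forall k, u k = u' k) -> Cconv u v n = Cconv u' v n.
Proof. intros H; apply sum_n_ext; intros k; now rewrite H. Qed.

Lemma Cconv_ext_r (u v v' : nat -> C) (n : nat) :
  (forall k, v k = v' k) -> Cconv u v n = Cconv u v' n.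
Proof. intros H; apply sum_n_ext; intros k; now rewrite H. Qed.

Lemma Cconv_plus_r (u v w : nat -> C) (n : nat) :
  Cconv u (fun k => v k + w k) n = Cconv u v n + Cconv u w n.
Proof.
unfold Cconv; rewrite <- Csum_plus; apply sum_n_ext; intros k. Cring.
Qed.

Lemma Cconv_scal_r (c : C) (u v : nat -> C) (n : nat) :
  Cconv u (fun k => c * v k) n = c * Cconv u v n.
Proof.
unfold Cconv; rewrite <- Csum_scal; apply sum_n_ext; intros k. Cring.
Qed.

Lemma Cconv_scal_l (c : C) (u v : nat -> C) (n : nat) :
  Cconv (fun k => c * u k) v n = c * Cconv u v n.
Proof.
unfold Cconv; rewrite <- Csum_scal; apply sum_n_ext; intros k. Cring.
Qed.

(** The Leibniz rule for [z d/dz]: it holds term by term since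
    [n = k + (n - k)]. *)
Lemma Cconv_euler (u v : nat -> C) (n : nat) :
  euler (Cconv u v) n = Cconv (euler u) v n + Cconv u (euler v) n.
Proof.
unfold euler at 1, Cconv; rewrite <- Csum_scal, <- Csum_plus.
apply sum_n_ext_loc; intros k Hk; unfold euler.
rewrite minus_INR, RtoC_minus by exact Hk. Cring.
Qed.

Lemma Cconv_shift_l (u v : nat -> C) (n : nat) :
  Cconv (shift u) v n = shift (Cconv u v) n.
Proof.
destruct n as [| n].
- unfold Cconv; rewrite sum_O; simpl; Cring.
- unfold Cconv; rewrite Csum_first; simpl shift.
  rewrite Cmult_0_l, Cplus_0_l. reflexivity.
Qed.

Lemma Cconv_shift_r (u v : nat -> C) (n : nat) :
  Cconv u (shift v) n = shift (Cconv u v) n.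
Proof.
destruct n as [| n].
- unfold Cconv; rewrite sum_O; simpl; Cring.
- unfold Cconv; rewrite Csum_Sn, Nat.sub_diag; simpl shift at 2.
  rewrite Cmult_0_r, Cplus_0_r; simpl shift at 2.
  apply sum_n_ext_loc; intros k Hk.
  now replace (S n - k)%nat with (S (n - k)) by lia.
Qed.

Definition exp_coef (c : C) (n : nat) : C := c ^ n / INR (fact n).

Definition kummer_coef (a b : C) (n : nat) : C :=
  Cpochhammer a n / Cpochhammer b n * exp_coef (2 * Ci) n.

Lemma INR_fact_C (n : nat) : RtoC (INR (fact n)) <> 0.
Proof. intros H; apply RtoC_inj in H; exact (INR_fact_neq_0 n H). Qed.

Lemma INR_S_C (n : nat) : RtoC (INR (S n)) <> 0.
Proof. intros H; apply RtoC_inj in H; now apply (not_0_INR (S n)). Qed.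

Lemma exp_coef_S (c : C) (n : nat) :
  RtoC (INR (S n)) * exp_coef c (S n) = c * exp_coef c n.
Proof.
unfold exp_coef; rewrite fact_simpl, mult_INR, RtoC_mult, Cpow_S.
assert (H1 := INR_fact_C n). assert (H2 := INR_S_C n). field. auto.
Qed.

Lemma euler_exp_coef (c : C) (n : nat) :
  euler (exp_coef c) n = c * shift (exp_coef c) n.
Proof.
destruct n as [| n]; unfold euler; simpl shift; [| apply exp_coef_S].
simpl INR; Cring.
Qed.

Lemma Cpochhammer_neq_0 (b : C) (n : nat) :
  (forall k, b + INR k <> 0) -> Cpochhammer b n <> 0.
Proof.
intros Hb; induction n as [| n IH]; simpl.
- intros H; apply RtoC_inj in H; lra.
- now apply Cmult_neq_0.
Qed.

Lemma kummer_coef_S (a b : C) (n : nat) :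
  (forall k, b + INR k <> 0) ->
  RtoC (INR (S n)) * (b + INR n) * kummer_coef a b (S n)
  = 2 * Ci * (a + INR n) * kummer_coef a b n.
Proof.
intros Hb; unfold kummer_coef; cbn [Cpochhammer].
assert (H1 := Cpochhammer_neq_0 b n Hb). assert (H2 := Hb n).
transitivity (Cpochhammer a n * (a + INR n) / Cpochhammer b n
  * (RtoC (INR (S n)) * exp_coef (2 * Ci) (S n))); [field; auto |].
rewrite exp_coef_S. field; auto.
Qed.

(** Coefficients of [e^(-iz) 1F1(a, b; 2iz)]. *)
Definition coulomb_coef (a b : C) : nat -> C :=
  Cconv (exp_coef (- Ci)) (kummer_coef a b).

Lemma coulomb_coef_0 (a b : C) : coulomb_coef a b O = 1.
Proof.
unfold coulomb_coef, Cconv, kummer_coef, exp_coef; rewrite sum_O; simpl.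
field.
Qed.

(** This is the Coulomb equation, read off coefficient by coefficient. Let
    [T] be the Euler operator and [X] the shift. The factors satisfy
    [T e = - i X e] and [T (T + b - 1) m = 2 i X (T + a) m]. Applying the
    Leibniz rule twice to [c = e * m] and eliminating [q = e * T m] by
    [q = T c + i X c] gives [T (T + b - 1) c = i (2 a - b) X c - X X c]. *)
Lemma coulomb_coef_rec (a b : C) (n : nat) :
  (forall k, b + INR k <> 0) ->
  RtoC (INR (S n)) * (b + INR n) * coulomb_coef a b (S n)
  = Ci * (2 * a - b) * coulomb_coef a b n - shift (coulomb_coef a b) n.
Proof.
intros Hb.
set (e := exp_coef (- Ci)). set (m := kummer_coef a b).
set (c := coulomb_coef a b). set (q := Cconv e (euler m)).
assert (Q : forall k, q k = euler c k + Ci * shift c k).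
{ intros k; unfold c, coulomb_coef; fold e m; rewrite Cconv_euler.
  rewrite (Cconv_ext_l (euler e) (fun j => - Ci * shift e j) m k (euler_exp_coef (- Ci))).
  rewrite Cconv_scal_l, Cconv_shift_l; fold e q. Cring. }
(* T q = (T e) * (T m) + e * (T T m), and T e = - i X e. *)
assert (E1 : euler q (S n) = - Ci * q n + Cconv e (euler (euler m)) (S n)).
{ unfold q at 1; rewrite Cconv_euler; f_equal.
  rewrite (Cconv_ext_l (euler e) (fun j => - Ci * shift e j) (euler m) (S n) (euler_exp_coef (- Ci))).
  rewrite Cconv_scal_l, Cconv_shift_l. reflexivity. }
(* Substitute the Kummer recurrence for T T m. *)
assert (E2 : Cconv e (euler (euler m)) (S n)
  = 2 * Ci * q n + 2 * Ci * a * c n + (1 - b) * q (S n)).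
{ rewrite (Cconv_ext_r e _ (fun k => (2 * Ci * shift (euler m) k
     + 2 * Ci * a * shift m k) + (1 - b) * euler m k)).
  - rewrite !Cconv_plus_r, !Cconv_scal_r, !Cconv_shift_r. reflexivity.
  - intros [| k]; unfold euler; cbn [shift]; [simpl INR; Cring |].
    assert (K := kummer_coef_S a b k Hb); fold m in K.
    rewrite S_INR, RtoC_plus in *.
    transitivity ((INR k + 1) * (b + INR k) * m (S k)
      + (INR k + 1) * (1 - b) * m (S k)); [Cring |].
    rewrite K. Cring. }
rewrite E2 in E1. unfold euler in E1. rewrite !Q in E1. unfold euler in E1; cbn [shift] in E1.
rewrite S_INR, RtoC_plus in *.
assert (I2 : Ci * Ci = -1) by (apply Ceq_Re_Im; simpl; ring).
set (N := RtoC (INR n)) in *.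
transitivity ((N + 1) * ((N + 1) * c (S n) + Ci * c n)
   - (1 - b) * ((N + 1) * c (S n) + Ci * c n) - (N + b) * Ci * c n); [Cring |].
rewrite E1.
transitivity (Ci * (2 * a - b) * c n + (Ci * Ci) * shift c n); [Cring |].
rewrite I2. Cring.
Qed.

Local Close Scope C_scope.

(** * Power series on the unit disk *)

Definition CPSeries (c : nat -> C) (z : C) : C := CSeries (fun n => c n * z ^ n)%C.

(** Weight [(n + 1)^p] rather than [n^p] keeps the constant term under
    control, so that [weighted 0] is absolute convergence on the closed disk.
    Termwise differentiation costs two powers, because the Taylor remainder
    of [z^n] at order one is bounded by [n^2 |y - z|^2]. *)
Definition weighted (p : nat) (c : nat -> C) : Prop :=
  ex_series (fun n => INR (S n) ^ p * Cmod (c n)).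

Lemma INR_S_ge_1 (n : nat) : 1 <= INR (S n).
Proof. rewrite S_INR; generalize (pos_INR n); lra. Qed.

Lemma weighted_le (p q : nat) (c : nat -> C) :
  (p <= q)%nat -> weighted q c -> weighted p c.
Proof.
intros Hpq Hq.
apply (ex_series_le (V := R_CompleteNormedModule)) with (2 := Hq); intros n.
change (Rabs (INR (S n) ^ p * Cmod (c n)) <= INR (S n) ^ q * Cmod (c n)).
assert (H1 := INR_S_ge_1 n).
rewrite Rabs_pos_eq.
- apply Rmult_le_compat_r; [apply Cmod_ge_0 |]. now apply Rle_pow.
- apply Rmult_le_pos; [apply pow_le; lra | apply Cmod_ge_0].
Qed.

Lemma Cmod_pow_le_1 (z : C) (n : nat) : Cmod z <= 1 -> Cmod (z ^ n)%C <= 1.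
Proof.
intros Hz; rewrite Cmod_pow, <- (pow1 n).
apply pow_incr; split; [apply Cmod_ge_0 | exact Hz].
Qed.

Lemma weighted_Csummable (c : nat -> C) (z : C) :
  weighted 0 c -> Cmod z <= 1 -> Csummable (fun n => c n * z ^ n)%C.
Proof.
intros Hc Hz; apply Csummable_le with (2 := Hc); intros n.
rewrite Cmod_mult, pow_O, Rmult_1_l.
generalize (Cmod_pow_le_1 z n Hz) (Cmod_ge_0 (c n)); nra.
Qed.

Lemma CPSeries_0 (c : nat -> C) : weighted 0 c -> CPSeries c 0%C = c O.
Proof.
intros Hc; unfold CPSeries.
rewrite CSeries_incr_1 by (apply weighted_Csummable; [exact Hc | rewrite Cmod_0; lra]).
rewrite (CSeries_ext _ (fun n => 0 * c n)%C) by (intros n; rewrite Cpow_S; ring).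
rewrite CSeries_scal.
- simpl; ring.
- apply (ex_series_ext (fun n => INR (S n) ^ 0 * Cmod (c n))); [| exact Hc].
  intros n; simpl; ring.
Qed.

Lemma Cpow_diff_le (y z : C) (n : nat) :
  Cmod y <= 1 -> Cmod z <= 1 ->
  Cmod (y ^ n - z ^ n)%C <= INR n * Cmod (y - z)%C.
Proof.
intros Hy Hz; induction n as [| n IH].
- simpl. replace (1 - 1)%C with (RtoC 0) by ring. rewrite Cmod_0; lra.
- rewrite !Cpow_S, S_INR.
  replace (y * y ^ n - z * z ^ n)%C with (y * (y ^ n - z ^ n) + (y - z) * z ^ n)%C by ring.
  eapply Rle_trans; [apply Cmod_triangle |]. rewrite !Cmod_mult.
  generalize (Cmod_pow_le_1 z n Hz) (Cmod_ge_0 (y - z)%C) (Cmod_ge_0 (y ^ n - z ^ n)%C)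
    (Cmod_ge_0 y); nra.
Qed.

(** The remainder [r n] satisfies
    [r (n + 1) = y * r n + n (y - z)^2 z^(n - 1)], so on the closed disk it
    grows by at most [n |y - z|^2] at each step. *)
Lemma Cpow_taylor1 (y z : C) (n : nat) :
  Cmod y <= 1 -> Cmod z <= 1 ->
  Cmod (y ^ n - z ^ n - (y - z) * (INR n * z ^ pred n))%C
  <= INR n ^ 2 * Cmod (y - z)%C ^ 2.
Proof.
intros Hy Hz; induction n as [| n IH].
- simpl. match goal with |- Cmod ?a <= _ => replace a with (RtoC 0) by ring end.
  rewrite Cmod_0; lra.
- set (r := (y ^ n - z ^ n - (y - z) * (INR n * z ^ pred n))%C) in *.
  replace (y ^ S n - z ^ S n - (y - z) * (INR (S n) * z ^ pred (S n)))%C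
    with (y * r + (y - z) * (y - z) * (INR n * z ^ pred n))%C.
  + eapply Rle_trans; [apply Cmod_triangle |].
    rewrite !Cmod_mult, Cmod_R, (Rabs_pos_eq (INR n)) by apply pos_INR.
    assert (H1 := Cmod_pow_le_1 z (pred n) Hz).
    assert (H2 := pos_INR n). assert (H3 := Cmod_ge_0 (y - z)%C).
    assert (H4 := Cmod_ge_0 r). assert (H5 := Cmod_ge_0 (z ^ pred n)%C).
    rewrite S_INR. set (m := Cmod (y - z)%C) in *.
    assert (T1 : Cmod y * Cmod r <= INR n ^ 2 * m ^ 2) by (generalize (Cmod_ge_0 y); nra).
    assert (T2 : m * m * (INR n * Cmod (z ^ pred n)%C) <= m ^ 2 * INR n).
    { replace (m ^ 2) with (m * m) by ring. apply Rmult_le_compat_l; nra. }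
    assert (0 <= m ^ 2) by nra. nra.
  + unfold r; rewrite S_INR, RtoC_plus; destruct n as [| n]; simpl pred.
    * simpl. ring.
    * rewrite !Cpow_S. ring.
Qed.

Lemma Cderiv_CPSeries (c : nat -> C) (z : C) :
  weighted 2 c -> in_disk z ->
  Cderiv (CPSeries c) z (CPSeries (fun n => INR (S n) * c (S n))%C z).
Proof.
intros Hc Hz; unfold in_disk in Hz.
assert (H0 : weighted 0 c) by (apply weighted_le with 2%nat; [lia | exact Hc]).
assert (H1 : weighted 1 c) by (apply weighted_le with 2%nat; [lia | exact Hc]).
(* At n = 0 the factor INR n cancels the meaningless exponent pred n. *)
assert (Hd : Csummable (fun n => c n * (INR n * z ^ pred n))%C).
{ apply Csummable_le with (2 := H1); intros n.
  rewrite !Cmod_mult, Cmod_R, Rabs_pos_eq, pow_1 by apply pos_INR.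
  assert (K1 := Cmod_pow_le_1 z (pred n) ltac:(lra)).
  assert (K2 := pos_INR n). assert (K3 := Cmod_ge_0 (c n)).
  assert (K4 := Cmod_ge_0 (z ^ pred n)%C). rewrite S_INR.
  rewrite Rmult_comm. apply Rmult_le_compat_r; [exact K3 | nra]. }
replace (CPSeries (fun n => INR (S n) * c (S n))%C z)
  with (CSeries (fun n => c n * (INR n * z ^ pred n))%C).
2:{ rewrite CSeries_incr_1 by exact Hd. simpl INR at 1.
    rewrite Cmult_0_l, Cmult_0_r, Cplus_0_l.
    apply CSeries_ext; intros n; simpl pred. ring. }
apply Cderiv_quadratic with (r := 1 - Cmod z)
  (M := Series (fun n => INR (S n) ^ 2 * Cmod (c n))); [lra |].
intros y Hy.
assert (Hy1 : Cmod y <= 1).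
{ replace y with ((y - z) + z)%C by ring.
  eapply Rle_trans; [apply Cmod_triangle | lra]. }
unfold CPSeries.
rewrite <- CSeries_scal by exact Hd.
rewrite <- CSeries_minus by (apply weighted_Csummable; auto; lra).
rewrite <- CSeries_minus.
2:{ eapply Csummable_le with (v := fun n => INR (S n) ^ 0 * Cmod (c n) + INR (S n) ^ 0 * Cmod (c n)).
    - intros n. unfold Cminus. eapply Rle_trans; [apply Cmod_triangle |].
      rewrite Cmod_opp, !Cmod_mult, pow_O, Rmult_1_l.
      generalize (Cmod_pow_le_1 z n ltac:(lra)) (Cmod_pow_le_1 y n Hy1) (Cmod_ge_0 (c n)); nra.
    - now apply (ex_series_plus (V := R_NormedModule)). }
2:{ now apply Csummable_scal. }
rewrite <- Series_scal_r.
apply Cmod_CSeries_le.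
- intros n.
  replace (c n * y ^ n - c n * z ^ n - (y - z) * (c n * (INR n * z ^ pred n)))%C
    with (c n * (y ^ n - z ^ n - (y - z) * (INR n * z ^ pred n)))%C by ring.
  rewrite Cmod_mult.
  assert (K := Cpow_taylor1 y z n Hy1 ltac:(lra)).
  replace (INR (S n) ^ 2 * Cmod (c n) * Cmod (y - z)%C ^ 2)
    with (Cmod (c n) * (INR (S n) ^ 2 * Cmod (y - z)%C ^ 2)) by ring.
  apply Rmult_le_compat_l; [apply Cmod_ge_0 |].
  eapply Rle_trans; [exact K |].
  apply Rmult_le_compat_r; [apply pow2_ge_0 |].
  apply pow_incr; split; [apply pos_INR | apply le_INR; lia].
- now apply ex_series_scal_r.
Qed.

Definition decays (c : nat -> C) : Prop :=
  exists K, forall n, Cmod (c n) <= K / 4 ^ n.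

Lemma INR_S_le_geom (n : nat) : INR (S n) <= 4 * (5 / 4) ^ n.
Proof.
induction n as [| n IH]; [simpl; lra |].
rewrite S_INR, <- tech_pow_Rmult.
assert (1 <= (5 / 4) ^ n) by (apply pow_R1_Rle; lra). lra.
Qed.

(** By Bernoulli [n + 1 <= 4 (5/4)^n], hence
    [(n + 1)^3 / 4^n <= 64 (125/256)^n]. *)
Lemma decays_weighted (c : nat -> C) : decays c -> weighted 3 c.
Proof.
intros [K HK].
assert (H : ex_series (fun n => (64 * K) * (125 / 256) ^ n)).
{ apply ex_series_Rscal, ex_series_geom. rewrite Rabs_pos_eq; lra. }
apply (ex_series_le (V := R_CompleteNormedModule)) with (2 := H); intros n.
change (Rabs (INR (S n) ^ 3 * Cmod (c n)) <= 64 * K * (125 / 256) ^ n).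
assert (H1 := INR_S_ge_1 n).
rewrite Rabs_pos_eq by (apply Rmult_le_pos; [apply pow_le; lra | apply Cmod_ge_0]).
replace (64 * K * (125 / 256) ^ n) with ((4 * (5 / 4) ^ n) ^ 3 * (K / 4 ^ n)).
- apply Rmult_le_compat; [apply pow_le; lra | apply Cmod_ge_0 | | apply HK].
  apply pow_incr; split; [lra | apply INR_S_le_geom].
- replace (125 / 256) with ((5 / 4) * (5 / 4) * (5 / 4) * / 4) by field.
  rewrite !Rpow_mult_distr, pow_inv. field. apply pow_nonzero; lra.
Qed.

(** The quotient [4^n / n!] is largest at [n = 3] and [n = 4], where it is
    32/3. *)
Lemma pow4_fact (n : nat) : 4 ^ n <= 11 * INR (fact n).
Proof.
destruct (Nat.le_gt_cases n 3) as [H | H].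
- destruct n as [| [| [| [| n]]]]; simpl; try lra; lia.
- induction H as [| n H IH]; [simpl; lra |].
  rewrite fact_simpl, mult_INR, <- tech_pow_Rmult.
  assert (4 <= INR (S n)) by (replace 4 with (INR 4) by (simpl; lra); apply le_INR; lia).
  assert (0 < 4 ^ n) by (apply pow_lt; lra).
  assert (0 < INR (fact n)) by apply INR_fact_lt_0. nra.
Qed.

Lemma exp_coef_decays (c : C) : Cmod c <= 1 -> decays (exp_coef c).
Proof.
intros Hc; exists 11; intros n; unfold exp_coef.
rewrite Cmod_div by apply INR_fact_C.
assert (Hf := INR_fact_lt_0 n).
rewrite Cmod_R, Rabs_pos_eq by lra.
assert (H4 : 0 < 4 ^ n) by (apply pow_lt; lra).
apply Rmult_le_reg_r with (INR (fact n) * 4 ^ n); [nra |].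
replace (Cmod (c ^ n)%C / INR (fact n) * (INR (fact n) * 4 ^ n))
  with (Cmod (c ^ n)%C * 4 ^ n) by (field; lra).
replace (11 / 4 ^ n * (INR (fact n) * 4 ^ n)) with (11 * INR (fact n)) by (field; lra).
generalize (pow4_fact n) (Cmod_pow_le_1 c n Hc) (Cmod_ge_0 (c ^ n)%C); nra.
Qed.

(** The sum [E] of the exponential series solves [E' = E], so
    [z |-> E z * Cexp (- z)] has zero derivative on the disk. *)
Lemma Cexp_CPSeries (z : C) : in_disk z -> CPSeries (exp_coef 1%C) z = Cexp z.
Proof.
intros Hz.
set (E := CPSeries (exp_coef 1%C)).
assert (W : weighted 3 (exp_coef 1%C)).
{ apply decays_weighted, exp_coef_decays. rewrite Cmod_1; lra. }
assert (HE : forall y, in_disk y -> Cderiv E y (E y)).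
{ intros y Hy.
  replace (E y) with (CPSeries (fun n => INR (S n) * exp_coef 1 (S n))%C y).
  - apply Cderiv_CPSeries; [apply weighted_le with 3%nat; [lia | exact W] | exact Hy].
  - apply CSeries_ext; intros n. rewrite exp_coef_S. ring. }
assert (H := Cderiv_zero_const (fun y => E y * Cexp (- (1) * y))%C z).
assert (Hc : (E z * Cexp (- (1) * z) = E 0 * Cexp (- (1) * 0))%C).
{ apply H; [| exact Hz]. intros y Hy.
  assert (Hid : Cderiv (fun x : C => (- (1) * x)%C) y (- (1))%C).
  { apply Cderiv_quadratic with (r := 1) (M := 0); [lra |]. intros x _.
    replace (- (1) * x - - (1) * y - (x - y) * - (1))%C with (RtoC 0) by ring.
    rewrite Cmod_0; lra. }
  replace (RtoC 0) with (E y * Cexp (- (1) * y) + E y * (- (1) * Cexp (- (1) * y)))%C by ring.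
  apply (Cderiv_mult E (fun x => Cexp (- (1) * x)%C)); [now apply HE |].
  apply (Cderiv_comp Cexp (fun x => - (1) * x)%C); [apply Cderiv_Cexp | exact Hid]. }
rewrite Cmult_0_r, Cexp_0 in Hc.
assert (E0 : E 0%C = 1%C).
{ unfold E; rewrite CPSeries_0 by (apply weighted_le with (2 := W); lia).
  unfold exp_coef; simpl; field. }
rewrite E0, !Cmult_1_r in Hc.
transitivity ((E z * Cexp (- (1) * z)) * Cexp z)%C.
- rewrite <- Cmult_assoc, <- Cexp_plus. replace (- (1) * z + z)%C with (RtoC 0) by ring.
  rewrite Cexp_0. ring.
- rewrite Hc. ring.
Qed.

(** * The Coulomb function as a power series *)

Lemma CPSeries_mult (c d : nat -> C) (z : C) :
  weighted 0 c -> weighted 0 d -> Cmod z <= 1 ->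
  CPSeries (Cconv c d) z = (CPSeries c z * CPSeries d z)%C.
Proof.
intros Hc Hd Hz; unfold CPSeries.
rewrite <- CSeries_conv by (apply weighted_Csummable; assumption).
apply CSeries_ext; intros n; unfold Cconv.
rewrite Cmult_comm, <- Csum_scal. apply sum_n_ext_loc; intros k Hk.
replace (z ^ n)%C with (z ^ k * z ^ (n - k))%C by (rewrite <- Cpow_add_r; f_equal; lia).
Cring.
Qed.

Lemma CPSeries_shift (c : nat -> C) (z : C) :
  weighted 0 c -> weighted 0 (shift c) -> Cmod z <= 1 ->
  CPSeries (shift c) z = (z * CPSeries c z)%C.
Proof.
intros Hc Hs Hz; unfold CPSeries.
rewrite <- CSeries_scal, CSeries_incr_1 by (apply weighted_Csummable; assumption).
simpl shift; rewrite Cmult_0_l, Cplus_0_l.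
apply CSeries_ext; intros n; rewrite Cpow_S; ring.
Qed.

Lemma weighted_shift (p : nat) (c : nat -> C) : weighted p c -> weighted p (shift c).
Proof.
intros Hc; unfold weighted; apply ex_series_incr_1.
assert (H := ex_series_Rscal (2 ^ p) _ Hc).
apply (ex_series_le (V := R_CompleteNormedModule)) with (2 := H); intros n.
change (Rabs (INR (S (S n)) ^ p * Cmod (c n)) <= 2 ^ p * (INR (S n) ^ p * Cmod (c n))).
assert (H1 := INR_S_ge_1 n).
rewrite Rabs_pos_eq by (apply Rmult_le_pos; [apply pow_le, pos_INR | apply Cmod_ge_0]).
rewrite <- Rmult_assoc, <- Rpow_mult_distr.
apply Rmult_le_compat_r; [apply Cmod_ge_0 |].
apply pow_incr; split; [apply pos_INR | rewrite (S_INR (S n)); lra].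
Qed.

(** If [|a + k| <= |b + k|] for all [k], the quotient of Pochhammer symbols has
    modulus at most 1 and the series is dominated by that of [e^(2iz)]. *)
Lemma kummer_coef_summable (a b : C) :
  (forall k, b + INR k <> 0)%C ->
  (forall k, Cmod (a + INR k)%C <= Cmod (b + INR k)%C) ->
  weighted 0 (kummer_coef a b).
Proof.
intros Hb Hab.
assert (Hp : forall n, Cmod (Cpochhammer a n) <= Cmod (Cpochhammer b n)).
{ induction n as [| n IH]; cbn [Cpochhammer]; [lra |].
  rewrite !Cmod_mult; apply Rmult_le_compat; auto using Cmod_ge_0. }
assert (H : ex_series (fun n => 11 * (1 / 2) ^ n)).
{ apply ex_series_Rscal, ex_series_geom. rewrite Rabs_pos_eq; lra. }
apply (ex_series_le (V := R_CompleteNormedModule)) with (2 := H); intros n.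
change (Rabs (INR (S n) ^ 0 * Cmod (kummer_coef a b n)) <= 11 * (1 / 2) ^ n).
rewrite pow_O, Rmult_1_l, Rabs_pos_eq by apply Cmod_ge_0.
assert (Hn := Cpochhammer_neq_0 b n Hb).
assert (Hm : 0 < Cmod (Cpochhammer b n)) by now apply Cmod_gt_0.
unfold kummer_coef; rewrite Cmod_mult, Cmod_div by exact Hn.
assert (Hq : Cmod (Cpochhammer a n) / Cmod (Cpochhammer b n) <= 1).
{ apply Rle_div_l; [exact Hm |]. rewrite Rmult_1_l; apply Hp. }
assert (He : Cmod (exp_coef (2 * Ci) n) <= 11 * (1 / 2) ^ n).
{ unfold exp_coef; rewrite Cmod_div by apply INR_fact_C.
  rewrite Cmod_pow, Cmod_mult, Cmod_Ci, !Cmod_R, Rmult_1_r, (Rabs_pos_eq 2) by lra.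
  assert (Hf := INR_fact_lt_0 n). rewrite Rabs_pos_eq by lra.
  apply Rle_div_l; [exact Hf |].
  replace (11 * (1 / 2) ^ n * INR (fact n)) with ((1 / 2) ^ n * (11 * INR (fact n))) by ring.
  replace (2 ^ n) with ((1 / 2) ^ n * 4 ^ n) by (rewrite <- Rpow_mult_distr; f_equal; field).
  apply Rmult_le_compat_l; [apply pow_le; lra | apply pow4_fact]. }
rewrite <- (Rmult_1_l (11 * (1 / 2) ^ n)).
apply Rmult_le_compat; auto using Cmod_ge_0.
apply Rmult_le_pos; [apply Cmod_ge_0 | left; now apply Rinv_0_lt_compat].
Qed.

Lemma Coulomb_g_CPSeries (L eta z : C) :
  let a := (L + 1 - Ci * eta)%C in
  let b := (2 * L + 2)%C in
  weighted 0 (kummer_coef a b) -> in_disk z ->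
  Coulomb_g L eta z = (z * CPSeries (coulomb_coef a b) z)%C.
Proof.
intros a b Hk Hz; unfold in_disk in Hz.
unfold Coulomb_g; fold a b.
rewrite <- Cmult_assoc; f_equal.
unfold coulomb_coef; rewrite CPSeries_mult; [| | exact Hk | lra].
2:{ apply weighted_le with 3%nat; [lia |]. apply decays_weighted, exp_coef_decays.
    rewrite Cmod_opp, Cmod_Ci; lra. }
f_equal.
- rewrite <- Cexp_CPSeries.
  + apply CSeries_ext; intros n; unfold exp_coef.
    replace (- (Ci * z))%C with (- Ci * z)%C by ring.
    rewrite Cpow_mult_l, Cpow_1_l. field. apply INR_fact_C.
  + unfold in_disk; rewrite Cmod_opp, Cmod_mult, Cmod_Ci; lra.
- apply CSeries_ext; intros n; unfold kummer_coef, exp_coef.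
  rewrite Cpow_mult_l. unfold Cdiv. ring.
Qed.

(** * Size of the coefficients *)

(** As [e >= (9/8)^8 > 2.565], the factor [e - 1] on the left is at least 3/2,
    while [(e - 1) / e^2], a decreasing function of [e >= 2], is at most
    0.238. *)
Lemma linear_budget (d t : R) : 0 <= d ->
  (exp 1 - 1) * d + t < (exp 1 - 1) / exp 1 ^ 2 -> t + 3 / 2 * d <= 0.238.
Proof.
intros Hd H.
assert (He : 2.565 <= exp 1).
{ assert (H8 : 9 / 8 <= exp (1 / 8)) by (generalize (exp_ineq1_le (1 / 8)); lra).
  assert (E : exp 1 = exp (1 / 8) ^ 8).
  { simpl; rewrite Rmult_1_r, <- !exp_plus; f_equal; field. }
  assert (P : (9 / 8) ^ 8 <= exp (1 / 8) ^ 8) by (apply pow_incr; lra).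
  lra. }
set (e := exp 1) in *.
assert (Hb : (e - 1) / e ^ 2 <= 0.238) by (apply Rle_div_l; nra).
nra.
Qed.

(** The recurrence for [|a_n|] is explicit enough to be iterated by hand. With
    [d = |2L - 1|] and [t = 2|eta|], the assumption leaves only a budget
    [t + 3/2 d <= 0.238]. The first two coefficients, which carry nearly the
    whole sum, are bounded by affine functions of [d]: separate worst cases for
    [t] and for [d] would push the sum above 1. From index 5 on, the
    recurrence sustains a decay by a factor 4 per step. *)
Section Majorant.
Variables (al : nat -> R) (t d : R).
Hypotheses (Hal : forall n, 0 <= al n) (Ht : 0 <= t) (Hd : 0 <= d)
  (Htd : t + 3 / 2 * d <= 0.238)
  (H0 : al 0%nat = 1) (H1 : (3 - d) * al 1%nat <= t)
  (Hrec : forall n, INR (S (S n)) * (INR n + 4 - d) * al (S (S n)) <= t * al (S n) + al n).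

Lemma majorant_1 : al 1%nat <= 0.0794 - 0.4 * d.
Proof. nra. Qed.

Lemma majorant_2 : al 2%nat <= 0.1275 + 0.02 * d.
Proof.
assert (K := Hrec 0); rewrite H0 in K; simpl in K.
assert (K1 := majorant_1). assert (K0 := Hal 1).
assert (t * al 1%nat <= (0.238 - 3 / 2 * d) * (0.0794 - 0.4 * d)) by (apply Rmult_le_compat; lra).
nra.
Qed.

Lemma majorant_3 : al 3%nat <= 0.0077.
Proof.
assert (K := Hrec 1); simpl in K. assert (K1 := majorant_1). assert (K2 := majorant_2).
assert (K0 := Hal 2). assert (K3 := Hal 3).
assert (t * al 2%nat <= 0.238 * 0.1308) by (apply Rmult_le_compat; lra).
nra.
Qed.

Lemma majorant_4 : al 4%nat <= 0.0057.
Proof.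
assert (K := Hrec 2); simpl in K. assert (K1 := majorant_2). assert (K2 := majorant_3).
assert (K0 := Hal 3). assert (K3 := Hal 4).
assert (t * al 3%nat <= 0.238 * 0.0077) by (apply Rmult_le_compat; lra).
nra.
Qed.

Lemma majorant_tail (n : nat) : al (5 + n)%nat <= 0.0006 / 4 ^ n.
Proof.
enough (H : al (5 + n)%nat <= 0.0006 / 4 ^ n /\ al (6 + n)%nat <= 0.0006 / 4 ^ S n) by apply H.
induction n as [| n [IH1 IH2]].
- assert (K5 : al 5%nat <= 0.0006).
  { assert (K := Hrec 3); simpl in K. assert (K1 := majorant_3). assert (K2 := majorant_4).
    assert (K0 := Hal 4). assert (K3 := Hal 5).
    assert (t * al 4%nat <= 0.238 * 0.0057) by (apply Rmult_le_compat; lra). nra. }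
  assert (K6 : al 6%nat <= 0.00015).
  { assert (K := Hrec 4); simpl in K. assert (K2 := majorant_4).
    assert (K0 := Hal 5). assert (K3 := Hal 6).
    assert (t * al 5%nat <= 0.238 * 0.0006) by (apply Rmult_le_compat; lra). nra. }
  simpl; lra.
- split; [exact IH2 |].
  assert (K := Hrec (5 + n)).
  replace (S (S (5 + n))) with (7 + n)%nat in K by lia.
  replace (S (5 + n)) with (6 + n)%nat in K by lia.
  change (6 + S n)%nat with (7 + n)%nat.
  assert (Hp : 0 < / 4 ^ n) by (apply Rinv_0_lt_compat, pow_lt; lra).
  unfold Rdiv in *. rewrite <- !tech_pow_Rmult in *. rewrite !Rinv_mult in *.
  set (x := / 4 ^ n) in *.
  assert (Hn := pos_INR n).
  rewrite !plus_INR in K.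
  replace (INR 7) with 7 in K by (simpl; ring).
  replace (INR 5) with 5 in K by (simpl; ring).
  assert (K0 := Hal (6 + n)). assert (K3 := Hal (7 + n)).
  assert (t * al (6 + n)%nat <= 0.238 * (0.0006 * (/ 4 * x))) by (apply Rmult_le_compat; lra).
  assert (7 * 8 * al (7 + n)%nat <= (7 + INR n) * (5 + INR n + 4 - d) * al (7 + n)%nat).
  { apply Rmult_le_compat_r; [exact K3 |]. apply Rmult_le_compat; lra. }
  lra.
Qed.

(** 1024 = 4^5 is generous for the first five terms and absorbs the offset of
    the tail bound. *)
Lemma majorant_decay (n : nat) : al n <= 1024 / 4 ^ n.
Proof.
assert (K1 := majorant_1). assert (K2 := majorant_2). assert (K3 := majorant_3). assert (K4 := majorant_4).
destruct n as [| [| [| [| [| n]]]]]; [simpl; lra .. |].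
eapply Rle_trans; [exact (majorant_tail n) |].
assert (Hp : 0 < / 4 ^ n) by (apply Rinv_0_lt_compat, pow_lt; lra).
change (4 ^ S (S (S (S (S n))))) with (4 * (4 * (4 * (4 * (4 * 4 ^ n))))).
unfold Rdiv; rewrite !Rinv_mult. lra.
Qed.

(** The first four terms are at most 0.8757 (for the first two together),
    7 * 0.0077 and 9 * 0.0057; the rest is at most 2 * 0.0066, for a total
    below 0.995. *)
Lemma majorant_sum :
  ex_series (fun n => (2 * INR (S n) + 1) * al (S n)) /\
  Series (fun n => (2 * INR (S n) + 1) * al (S n)) < 1.
Proof.
set (w := fun n => (2 * INR (S n) + 1) * al (S n)).
assert (Hw0 : forall n, 0 <= w n).
{ intros n; apply Rmult_le_pos; [generalize (pos_INR (S n)); lra | apply Hal]. }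
assert (Htail : forall n, w (4 + n)%nat <= 0.0066 * (1 / 2) ^ n).
{ intros n; unfold w. change (S (4 + n)) with (5 + n)%nat.
  rewrite plus_INR; replace (INR 5) with 5 by (simpl; ring).
  assert (Hn : 2 * (5 + INR n) + 1 <= 11 * 2 ^ n).
  { induction n as [| n IH]; [simpl; lra |].
    rewrite S_INR, <- tech_pow_Rmult. assert (1 <= 2 ^ n) by (apply pow_R1_Rle; lra). lra. }
  replace (0.0066 * (1 / 2) ^ n) with ((11 * 2 ^ n) * (0.0006 / 4 ^ n)).
  - apply Rmult_le_compat; [generalize (pos_INR n); lra | apply Hal | exact Hn | apply majorant_tail].
  - replace (1 / 2) with (2 * / 4) by field.
    rewrite Rpow_mult_distr, pow_inv. lra. }
assert (Hg : ex_series (fun n => 0.0066 * (1 / 2) ^ n)).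
{ apply ex_series_Rscal, ex_series_geom. rewrite Rabs_pos_eq; lra. }
assert (E4 : ex_series (fun n => w (4 + n)%nat)).
{ apply (ex_series_le (V := R_CompleteNormedModule)) with (2 := Hg); intros n.
  change (Rabs (w (4 + n)%nat) <= 0.0066 * (1 / 2) ^ n).
  rewrite Rabs_pos_eq by apply Hw0. apply Htail. }
assert (E3 : ex_series (fun n => w (3 + n)%nat)) by (apply ex_series_incr_1; exact E4).
assert (E2 : ex_series (fun n => w (2 + n)%nat)) by (apply ex_series_incr_1; exact E3).
assert (E1 : ex_series (fun n => w (1 + n)%nat)) by (apply ex_series_incr_1; exact E2).
assert (E0 : ex_series w) by (apply ex_series_incr_1; exact E1).
split; [exact E0 |].
rewrite Series_incr_1 by exact E0.
rewrite (Series_incr_1 (fun n => w (S n))) by exact E1.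
rewrite (Series_incr_1 (fun n => w (S (S n)))) by exact E2.
rewrite (Series_incr_1 (fun n => w (S (S (S n))))) by exact E3.
assert (S4 : Series (fun n => w (4 + n)%nat) <= 0.0132).
{ apply Rle_trans with (Series (fun n => 0.0066 * (1 / 2) ^ n)).
  - apply Series_le; [intros n; split; [apply Hw0 | apply Htail] | exact Hg].
  - rewrite Series_scal_l, Series_geom by (rewrite Rabs_pos_eq; lra). lra. }
change (Series (fun k => w (S (S (S (S k))))) <= 0.0132) in S4.
assert (K1 := majorant_1). assert (K2 := majorant_2). assert (K3 := majorant_3). assert (K4 := majorant_4).
unfold w at 1 2 3 4. simpl INR. lra.
Qed.
End Majorant.

(** * The principal logarithm near 1 *)

(** The principal logarithm, on the right half-plane only, where the argument
    is an arctangent. *)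
Definition Clog (z : C) : C := (ln (Cmod z), atan (Im z / Re z)).

Lemma Cmod_polar (x y : R) : 0 < x -> Cmod (x, y) = x * sqrt (1 + (y / x)²).
Proof.
intros Hx. unfold Cmod; simpl fst; simpl snd.
replace (x ^ 2 + y ^ 2) with (x² * (1 + (y / x)²)) by (unfold Rsqr; field; lra).
rewrite sqrt_mult_alt by apply Rle_0_sqr. now rewrite sqrt_Rsqr by lra.
Qed.

Lemma Cexp_Clog (z : C) : 0 < Re z -> Cexp (Clog z) = z.
Proof.
destruct z as [x y]; simpl; intros Hx.
assert (Hs : 0 < sqrt (1 + (y / x)²)).
{ apply sqrt_lt_R0. generalize (Rle_0_sqr (y / x)); lra. }
unfold Cexp, Clog; simpl Re; simpl Im.
rewrite Cmod_polar by exact Hx.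
rewrite exp_ln by now apply Rmult_lt_0_compat.
rewrite cos_atan, sin_atan.
apply Ceq_Re_Im; simpl; field; lra.
Qed.

Lemma atan_le_id (s : R) : Rabs (atan s) <= Rabs s.
Proof.
replace (atan s) with (atan s - atan 0) by (rewrite atan_0; ring).
replace (Rabs s) with (1 * Rabs (s - 0)) by (rewrite Rminus_0_r; ring).
apply bounded_variation with (dh := fun u => / (1 + u²)); intros u _; split.
- apply is_derive_atan.
- assert (H := Rle_0_sqr u).
  rewrite Rabs_pos_eq by (left; apply Rinv_0_lt_compat; lra).
  rewrite <- Rinv_1. apply Rinv_le_contravar; lra.
Qed.

Lemma exp_opp_4_5_le_half : exp (- (4 / 5)) <= 1 / 2.
Proof.
assert (H : 6 / 5 <= exp (1 / 5)) by (generalize (exp_ineq1_le (1 / 5)); lra).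
assert (E : exp (4 / 5) = exp (1 / 5) ^ 4).
{ simpl; rewrite Rmult_1_r, <- !exp_plus; f_equal; field. }
assert (H4 : (6 / 5) ^ 4 <= exp (1 / 5) ^ 4) by (apply pow_incr; lra).
rewrite exp_Ropp. unfold Rdiv; rewrite Rmult_1_l.
apply Rinv_le_contravar; lra.
Qed.

(** The disk of centre 1 and radius 1/2 lies in the sector of half-angle
    [pi/6]. *)
Lemma half_disk_bounds (x y : R) :
  (x - 1) ^ 2 + y ^ 2 <= 1 / 4 -> 1 / 2 <= x /\ 3 * y ^ 2 <= x ^ 2.
Proof. intros H; split; [nra |]. assert (K := pow2_ge_0 (2 * x - 3 / 2)). nra. Qed.

(** On this disk [|ln |z|| <= ln 2 <= 4/5] and the argument is at most
    [1 / sqrt 3] in modulus; 16/25 + 1/3 < 1. *)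
Lemma Cmod_Clog (z : C) : Cmod (z - 1)%C <= 1 / 2 -> 0 < Re z /\ Cmod (Clog z) < 1.
Proof.
intros Hz.
assert (Hq : Cmod (z - 1)%C ^ 2 <= 1 / 4) by (generalize (Cmod_ge_0 (z - 1)%C); nra).
assert (Hr : 1 / 2 <= Cmod z <= 3 / 2).
{ assert (T1 := Cmod_triangle (z - 1)%C 1%C).
  assert (T2 := Cmod_triangle z (- (z - 1))%C).
  replace (z - 1 + 1)%C with z in T1 by ring.
  replace (z + - (z - 1))%C with (RtoC 1) in T2 by ring.
  rewrite Cmod_opp in T2. rewrite Cmod_1 in *. lra. }
rewrite Cmod_sqr in Hq. destruct z as [x y]; simpl in Hq.
destruct (half_disk_bounds x y) as [Hx Hy]; [simpl; lra |].
split; [simpl; lra |].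
unfold Clog; simpl Re; simpl Im. set (r := Cmod (x, y)) in *.
assert (Hln : Rabs (ln r) <= 4 / 5).
{ apply Rabs_le; split.
  - rewrite <- (ln_exp (- (4 / 5))). apply ln_le; [apply exp_pos |].
    generalize exp_opp_4_5_le_half; lra.
  - assert (K := exp_ineq1_le (ln r)). rewrite exp_ln in K by lra. lra. }
assert (Hat : atan (y / x) ^ 2 <= 1 / 3).
{ apply Rle_trans with ((y / x) ^ 2).
  - rewrite <- !Rsqr_pow2. apply Rsqr_le_abs_1, atan_le_id.
  - replace ((y / x) ^ 2) with (y ^ 2 / x ^ 2) by (field; lra).
    apply Rle_div_l; nra. }
assert (Hl2 : ln r ^ 2 <= (4 / 5) ^ 2).
{ rewrite <- (pow2_abs (ln r)). apply pow_incr; split; [apply Rabs_pos | exact Hln]. }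
assert (K := Cmod_sqr (ln r, atan (y / x))). simpl Re in K; simpl Im in K.
assert (K0 := Cmod_ge_0 (ln r, atan (y / x))). nra.
Qed.

Lemma Clog_continuous (z0 : C) :
  0 < Re z0 ->
  forall eps : posreal, exists delta : posreal, forall z,
    Cmod (z - z0)%C < delta -> Cmod (Clog z - Clog z0)%C < eps.
Proof.
intros Hx eps.
assert (Hm : 0 < Cmod z0).
{ eapply Rlt_le_trans; [| apply Re_le_Cmod]. rewrite Rabs_pos_eq; lra. }
assert (Cln : continuous (T := C_UniformSpace) (U := R_UniformSpace) (fun z : C => ln (Cmod z)) z0).
{ apply continuous_comp.
  - apply (filterlim_norm (K := C_AbsRing) (V := C_NormedModule)).
  - apply (ex_derive_continuous (V := R_NormedModule)). eexists; now apply is_derive_ln. }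
assert (Cat : continuous (T := C_UniformSpace) (U := R_UniformSpace) (fun z : C => atan (Im z / Re z)) z0).
{ apply (continuous_comp (fun z : C => Im z / Re z) atan).
  - apply (continuous_mult (K := R_AbsRing) (fun z : C => Im z) (fun z : C => / Re z)).
    + apply continuous_snd.
    + apply (continuous_comp (fun z : C => Re z) Rinv); [apply continuous_fst |].
      apply (ex_derive_continuous (V := R_NormedModule)). auto_derive. lra.
  - apply (ex_derive_continuous (V := R_NormedModule)). eexists; apply is_derive_atan. }
assert (He2 : 0 < eps / 2) by (generalize (cond_pos eps); lra).
set (e2 := mkposreal _ He2).
apply (proj1 (filterlim_locally _ _)) with (eps := e2) in Cln.
apply (proj1 (filterlim_locally _ _)) with (eps := e2) in Cat.
assert (Hl := filter_and _ _ Cln Cat).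
apply locally_C in Hl. destruct Hl as [delta Hd].
exists delta; intros z Hz. destruct (Hd z Hz) as [H1 H2].
change (Rabs (ln (Cmod z) - ln (Cmod z0)) < eps / 2) in H1.
change (Rabs (atan (Im z / Re z) - atan (Im z0 / Re z0)) < eps / 2) in H2.
eapply Rle_lt_trans; [apply Cmod_le_Re_Im |].
unfold Clog; simpl Re; simpl Im.
unfold Rminus in H1, H2. simpl. unfold Re, Im in *. lra.
Qed.

(** [Clog] is a continuous local section of [Cexp], whose derivative does
    not vanish. *)
Lemma Cderiv_Clog (z : C) : 0 < Re z -> Cderiv Clog z (/ z)%C.
Proof.
intros Hz.
assert (H0 : z <> 0%C) by (intros ->; simpl in Hz; lra).
apply Cderiv_inverse with (f := Cexp); [exact H0 | | | now apply Clog_continuous].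
- rewrite <- (Cexp_Clog z Hz) at 2. apply Cderiv_Cexp.
- exists (Re z); split; [exact Hz |]. intros y Hy. apply Cexp_Clog.
  assert (K := Re_le_Cmod (y - z)%C). destruct y as [a b], z as [c e]; simpl in *.
  apply Rle_lt_trans with (2 := Hy) in K.
  apply Rabs_lt_between in K. lra.
Qed.

(** * Small coefficients imply exponential starlikeness *)

(** Let [S] be the sum of [(2n + 1) |a_n|] over [n >= 1], and let
    [f z = z h z]. As [n + 1 <= 2n + 1], the bound [S < 1] makes [f] a small
    perturbation of the identity. With [A] the sum of [n |a_n|] and [B] the sum
    of [|a_n|], it also reads [2 A + B < 1], which is exactly what
    [|f' - h| <= A] and [|h| >= 1 - B] need to put [f' / h] within 1/2 of 1. *)
Section Coefficients.
Variables (f : C -> C) (a : nat -> C).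
Hypotheses (a0 : a O = 1%C) (Ha : weighted 3 a)
  (Hsum : Series (fun n => (2 * INR (S n) + 1) * Cmod (a (S n))) < 1)
  (Hf : forall z, in_disk z -> f z = (z * CPSeries a z)%C).

Let h := CPSeries a.
Let k := CPSeries (fun n => INR (S n) * a n)%C.
Let p (z : C) : C := (k z * / h z)%C.

Lemma weighted_coef (q : nat) : (q <= 3)%nat -> weighted q a.
Proof. intros Hq; now apply weighted_le with 3%nat. Qed.

Lemma weighted_derivative : weighted 2 (fun n => INR (S n) * a n)%C.
Proof.
apply (ex_series_ext (fun n => INR (S n) ^ 3 * Cmod (a n))); [| exact Ha].
intros n; rewrite Cmod_mult, Cmod_R, Rabs_pos_eq by apply pos_INR. simpl; ring.
Qed.

Lemma ex_series_coef (u v : R) :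
  ex_series (fun n => (u * INR (S n) + v) * Cmod (a (S n))).
Proof.
assert (H1 : ex_series (fun n => u * (INR (S n) * Cmod (a (S n))) + v * Cmod (a (S n)))).
{ apply (ex_series_plus (V := R_NormedModule)); apply ex_series_Rscal.
  - assert (W : ex_series (fun n => INR n * Cmod (a n))).
    { apply (ex_series_le (V := R_CompleteNormedModule))
        with (2 := weighted_coef 1 ltac:(lia)); intros n.
      change (Rabs (INR n * Cmod (a n)) <= INR (S n) ^ 1 * Cmod (a n)).
      rewrite Rabs_pos_eq by (apply Rmult_le_pos; [apply pos_INR | apply Cmod_ge_0]).
      apply Rmult_le_compat_r; [apply Cmod_ge_0 |]. rewrite S_INR; simpl; lra. }
    now apply ex_series_incr_1 in W.
  - assert (W := weighted_coef 0 ltac:(lia)). unfold weighted in W.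
    apply ex_series_incr_1 in W.
    eapply ex_series_ext; [| exact W]. intros n; simpl; apply Rmult_1_l. }
eapply ex_series_ext; [| exact H1]. intros n; simpl; ring.
Qed.

Lemma Cderiv_f (z : C) : in_disk z -> Cderiv f z (k z).
Proof.
intros Hz.
apply Cderiv_ext_disk with (g := CPSeries (shift a)); [| exact Hz |].
- intros y Hy; rewrite Hf by exact Hy. symmetry; apply CPSeries_shift.
  + apply weighted_coef; lia.
  + apply weighted_shift, weighted_coef; lia.
  + unfold in_disk in Hy; lra.
- apply (Cderiv_CPSeries (shift a)); [| exact Hz].
  apply weighted_shift, weighted_coef; lia.
Qed.

(** [|f x - f y - (x - y)| <= S |x - y|] with [S < 1]. *)
Lemma f_univalent : univalent_disk f.
Proof.
intros x y Hx Hy E. 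
rewrite !Hf in E by assumption. unfold in_disk in Hx, Hy.
assert (W : weighted 0 (shift a)) by (apply weighted_shift, weighted_coef; lia).
assert (W0 : weighted 0 a) by (apply weighted_coef; lia).
rewrite <- !CPSeries_shift in E by (assumption || lra).
unfold CPSeries in E.
assert (Sx := weighted_Csummable _ x W ltac:(lra)).
assert (Sy := weighted_Csummable _ y W ltac:(lra)).
assert (T0 : CSeries (fun n => shift a n * x ^ n - shift a n * y ^ n)%C = 0%C).
{ rewrite CSeries_minus by assumption. rewrite E. ring. }
assert (D : Csummable (fun n => shift a n * x ^ n - shift a n * y ^ n)%C).
{ eapply Csummable_le; [intros n; apply Cmod_triangle |].
  apply (ex_series_plus (V := R_NormedModule)); [exact Sx |].
  eapply ex_series_ext; [| exact Sy]. intros n; simpl; now rewrite Cmod_opp. }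
assert (D1 : Csummable (fun n => shift a (S n) * x ^ (S n) - shift a (S n) * y ^ (S n))%C).
{ unfold Csummable in *. now apply ex_series_incr_1 in D. }
rewrite CSeries_incr_1 in T0 by exact D.
rewrite CSeries_incr_1 in T0 by exact D1.
cbn [shift] in T0. rewrite a0 in T0.
(* The terms of index 0 and 1 contribute 0 and x - y. *)
set (s := CSeries (fun n => a (S n) * x ^ S (S n) - a (S n) * y ^ S (S n))%C) in T0.
assert (Hs : (x - y = - s)%C).
{ transitivity ((x - y) - (0 * x ^ 0 - 0 * y ^ 0 + (1 * x ^ 1 - 1 * y ^ 1 + s)))%C.
  - rewrite T0; ring.
  - simpl; ring. }
assert (Hle : Cmod s <= Series (fun n => (2 * INR (S n) + 1) * Cmod (a (S n))) * Cmod (x - y)%C).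
{ rewrite <- Series_scal_r. apply Cmod_CSeries_le; [| apply ex_series_scal_r, ex_series_coef].
  intros n.
  replace (a (S n) * x ^ S (S n) - a (S n) * y ^ S (S n))%C
    with (a (S n) * (x ^ S (S n) - y ^ S (S n)))%C by ring.
  rewrite Cmod_mult.
  assert (K := Cpow_diff_le x y (S (S n)) ltac:(lra) ltac:(lra)).
  replace ((2 * INR (S n) + 1) * Cmod (a (S n)) * Cmod (x - y)%C)
    with (Cmod (a (S n)) * ((2 * INR (S n) + 1) * Cmod (x - y)%C)) by ring.
  apply Rmult_le_compat_l; [apply Cmod_ge_0 |].
  eapply Rle_trans; [exact K |]. apply Rmult_le_compat_r; [apply Cmod_ge_0 |].
  rewrite (S_INR (S n)). generalize (pos_INR (S n)); lra. }
rewrite <- (Cmod_opp s), <- Hs in Hle.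
destruct (Ceq_dec x y) as [e | ne]; [exact e | exfalso].
assert (Hpos : 0 < Cmod (x - y)%C).
{ apply Cmod_gt_0. intros Z. apply ne. replace x with ((x - y) + y)%C by ring. rewrite Z. ring. }
nra.
Qed.

Lemma quotient_bound (z : C) :
  in_disk z -> h z <> 0%C /\ Cmod (p z - 1)%C <= 1 / 2.
Proof.
intros Hz; unfold in_disk in Hz.
assert (W0 : weighted 0 a) by (apply weighted_coef; lia).
assert (Wk : weighted 0 (fun n => INR (S n) * a n)%C)
  by (apply weighted_le with (2 := weighted_derivative); lia).
assert (Sh := weighted_Csummable _ z W0 ltac:(lra)).
assert (Sk := weighted_Csummable _ z Wk ltac:(lra)).
set (A := Series (fun n => (1 * INR (S n) + 0) * Cmod (a (S n)))).
set (B := Series (fun n => (0 * INR (S n) + 1) * Cmod (a (S n)))).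
assert (HAB : 2 * A + B < 1).
{ eapply Rle_lt_trans; [right | exact Hsum].
  unfold A, B. rewrite <- Series_scal_l, <- Series_plus;
    [apply Series_ext; intros n; ring | apply ex_series_Rscal, ex_series_coef | apply ex_series_coef]. }
assert (HB : Cmod (h z - 1)%C <= B).
{ unfold h, CPSeries. rewrite CSeries_incr_1 by exact Sh. rewrite a0.
  set (s := CSeries _). replace (1 * z ^ 0 + s - 1)%C with s by (simpl; ring). unfold s.
  apply Cmod_CSeries_le; [intros n | apply ex_series_coef].
  rewrite Cmod_mult.
  generalize (Cmod_pow_le_1 z (S n) ltac:(lra)) (Cmod_ge_0 (a (S n))); nra. }
assert (HA : Cmod (k z - h z)%C <= A).
{ unfold k, h, CPSeries. rewrite <- CSeries_minus by assumption.
  assert (S' : Csummable (fun n => INR (S n) * a n * z ^ n - a n * z ^ n)%C).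
  { eapply Csummable_le; [intros n; apply Cmod_triangle |].
    apply (ex_series_plus (V := R_NormedModule)); [exact Sk |].
    eapply ex_series_ext; [| exact Sh]. intros n; simpl; now rewrite Cmod_opp. }
  rewrite CSeries_incr_1 by exact S'.
  set (s := CSeries _).
  replace (INR 1 * a 0%nat * z ^ 0 - a 0%nat * z ^ 0 + s)%C with s by (simpl; ring).
  unfold s.
  apply Cmod_CSeries_le; [intros n | apply ex_series_coef].
  replace (INR (S (S n)) * a (S n) * z ^ S n - a (S n) * z ^ S n)%C
    with (INR (S n) * a (S n) * z ^ S n)%C by (rewrite (S_INR (S n)), RtoC_plus; ring).
  rewrite !Cmod_mult, Cmod_R, Rabs_pos_eq by apply pos_INR.
  assert (K1 := Cmod_pow_le_1 z (S n) ltac:(lra)).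
  assert (K2 := Rmult_le_pos _ _ (pos_INR (S n)) (Cmod_ge_0 (a (S n)))).
  nra. }
assert (Hh : 1 - B <= Cmod (h z)).
{ assert (T := Cmod_triangle (h z) (- (h z - 1))%C).
  replace (h z + - (h z - 1))%C with (RtoC 1) in T by ring.
  rewrite Cmod_opp, Cmod_1 in T. lra. }
assert (HA0 := Cmod_ge_0 (k z - h z)%C).
assert (Hn : h z <> 0%C) by (apply Cmod_gt_0; lra).
split; [exact Hn |].
unfold p. replace (k z * / h z - 1)%C with ((k z - h z) * / h z)%C by (field; exact Hn).
rewrite Cmod_mult, Cmod_inv by exact Hn.
apply Rle_div_l; lra.
Qed.

Lemma quotient_0 : p 0%C = 1%C.
Proof.
unfold p, k, h. rewrite !CPSeries_0.
- rewrite a0. simpl. field.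
- apply weighted_coef; lia.
- apply weighted_le with (2 := weighted_derivative); lia.
Qed.

Lemma quotient_analytic (z : C) : in_disk z -> exists d, Cderiv p z d.
Proof.
intros Hz; eexists.
apply Cderiv_mult.
- apply Cderiv_CPSeries; [exact weighted_derivative | exact Hz].
- apply (Cderiv_comp Cinv h).
  + apply Cderiv_Cinv, quotient_bound, Hz.
  + apply Cderiv_CPSeries; [apply weighted_coef; lia | exact Hz].
Qed.

Lemma starlike_quotient_eq (z : C) : in_disk z -> starlike_quotient f z = p z.
Proof.
intros Hz; unfold starlike_quotient.
destruct (Ceq_dec z 0) as [-> | Hn]; [now rewrite quotient_0 |].
rewrite (is_C_derive_unique _ _ _ (Cderiv_f z Hz)), Hf by exact Hz.
destruct (quotient_bound z Hz) as [Hh _].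
unfold p; fold h. field; auto.
Qed.

(** The function [w] of the subordination is the logarithm of the quotient. *)
Lemma exponential_starlike_of_coef : exponential_starlike f.
Proof.
assert (D0 : in_disk 0%C) by (unfold in_disk; rewrite Cmod_0; lra).
split; [split; [split; [| split] | exact f_univalent] | split; [| split]].
- intros z Hz; eexists; now apply Cderiv_f.
- rewrite Hf by exact D0. ring.
- rewrite (is_C_derive_unique _ _ _ (Cderiv_f _ D0)).
  unfold k; rewrite CPSeries_0 by (apply weighted_le with (2 := weighted_derivative); lia).
  rewrite a0; simpl; ring.
- intros z Hz. destruct (quotient_analytic z Hz) as [d Hd]. exists d.
  exact (Cderiv_ext_disk _ _ z d starlike_quotient_eq Hz Hd).
- intros z Hz; eexists; apply Cderiv_Cexp.
- exists (fun z => Clog (p z)); split; [| split].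
  + intros z Hz. destruct (quotient_analytic z Hz) as [d Hd]. eexists.
    apply (Cderiv_comp Clog p); [| exact Hd].
    apply Cderiv_Clog, Cmod_Clog, quotient_bound, Hz.
  + rewrite quotient_0. unfold Clog. rewrite Cmod_1, ln_1.
    apply Ceq_Re_Im; simpl; [reflexivity |].
    replace (0 / 1) with 0 by field. apply atan_0.
  + intros z Hz. destruct (quotient_bound z Hz) as [_ Hb].
    destruct (Cmod_Clog (p z) Hb) as [Hre Hlt]. split; [exact Hlt |].
    rewrite Cexp_Clog by exact Hre. now apply starlike_quotient_eq.
Qed.
End Coefficients.

Theorem theorem3 (L eta : C)
  (H : ((exp 1 - 1) * Cmod (2 * L - 1)%C + 2 * Cmod eta
        < (exp 1 - 1) / exp 1 ^ 2)%R) :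
  exponential_starlike (fun z : C => Coulomb_g L eta z).
Proof.
set (d := Cmod (2 * L - 1)%C) in *. set (t := 2 * Cmod eta) in *.
assert (Hd : 0 <= d) by apply Cmod_ge_0.
assert (Ht : 0 <= t) by (unfold t; generalize (Cmod_ge_0 eta); lra).
assert (Htd := linear_budget d t Hd H).
set (a := (L + 1 - Ci * eta)%C). set (b := (2 * L + 2)%C).
(* b = 3 + (2L - 1). *)
assert (Hbk : forall n, INR n + 3 - d <= Cmod (b + INR n)%C).
{ intros n. assert (T := Cmod_triangle (b + INR n)%C (- (2 * L - 1))%C).
  replace (b + INR n + - (2 * L - 1))%C with (RtoC (INR n + 3)) in T
    by (unfold b; rewrite RtoC_plus; ring).
  rewrite Cmod_opp, Cmod_R, Rabs_pos_eq in T by (generalize (pos_INR n); lra).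
  fold d in T. lra. }
assert (Hb : forall n, (b + INR n <> 0)%C).
{ intros n. apply Cmod_gt_0. generalize (Hbk n) (pos_INR n); lra. }
assert (Hab : forall n, Cmod (a + INR n)%C <= Cmod (b + INR n)%C).
{ intros n. eapply Rle_trans; [| apply Hbk].
  replace (a + INR n)%C
    with (RtoC (INR n + 3 / 2) + (RtoC (1 / 2) * (2 * L - 1) + - (Ci * eta)))%C.
  (* a = 3/2 + (2L - 1)/2 - i eta. *)
  - assert (T1 := Cmod_triangle (RtoC (INR n + 3 / 2)) (RtoC (1 / 2) * (2 * L - 1) + - (Ci * eta))%C).
    assert (T2 := Cmod_triangle (RtoC (1 / 2) * (2 * L - 1))%C (- (Ci * eta))%C).
    rewrite Cmod_opp, !Cmod_mult, Cmod_Ci, Cmod_R, Rabs_pos_eq in T2 by lra.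
    rewrite Cmod_R, Rabs_pos_eq in T1 by (generalize (pos_INR n); lra).
    fold d in T2. unfold t in *. lra.
  - unfold a. rewrite RtoC_plus, !RtoC_div by lra. field; intros Z; apply RtoC_inj in Z; lra. }
assert (Hk := kummer_coef_summable a b Hb Hab).
set (c := coulomb_coef a b).
assert (Hc0 : c O = 1%C) by apply coulomb_coef_0.
assert (I2 : (Ci * (2 * a - b) = 2 * eta)%C).
{ unfold a, b. apply Ceq_Re_Im; destruct L, eta; simpl; ring. }
set (al := fun n => Cmod (c n)).
assert (Hal : forall n, 0 <= al n) by (intros n; apply Cmod_ge_0).
assert (Hal0 : al O = 1) by (unfold al; rewrite Hc0; apply Cmod_1).
assert (Hal1 : (3 - d) * al 1%nat <= t).
{ assert (K := coulomb_coef_rec a b 0 Hb). fold c in K.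
  rewrite I2, Hc0 in K. apply (f_equal Cmod) in K. simpl shift in K.
  replace (2 * eta * 1 - 0)%C with (2 * eta)%C in K by ring.
  rewrite !Cmod_mult, !Cmod_R, !Rabs_pos_eq in K by (simpl; lra).
  simpl (INR 1) in K. fold t in K. fold (al 1%nat) in K.
  assert (B0 := Hbk 0%nat). simpl (INR 0) in *.
  rewrite <- K. rewrite Rmult_1_l. apply Rmult_le_compat_r; [apply Hal | lra]. }
assert (Hrec : forall n, INR (S (S n)) * (INR n + 4 - d) * al (S (S n)) <= t * al (S n) + al n).
{ intros n. assert (K := coulomb_coef_rec a b (S n) Hb). fold c in K.
  rewrite I2 in K. apply (f_equal Cmod) in K. cbn [shift] in K.
  assert (T := Cmod_triangle (2 * eta * c (S n))%C (- c n)%C).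
  rewrite Cmod_opp in T.
  change (2 * eta * c (S n) + - c n)%C with (2 * eta * c (S n) - c n)%C in T.
  rewrite <- K in T.
  rewrite !Cmod_mult, !Cmod_R, !Rabs_pos_eq in T by (apply pos_INR || lra).
  fold t (al (S (S n))) (al (S n)) (al n) in T.
  eapply Rle_trans; [| exact T].
  apply Rmult_le_compat_r; [apply Hal |]. apply Rmult_le_compat_l; [apply pos_INR |].
  assert (B0 := Hbk (S n)). rewrite (S_INR n) in B0. rewrite S_INR. lra. }
apply (exponential_starlike_of_coef _ c).
- exact Hc0.
- apply decays_weighted. exists 1024. intros n.
  now apply (majorant_decay al t d).
- now apply (majorant_sum al t d).
- intros z Hz. now apply Coulomb_g_CPSeries.
Qed.
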